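(* Let $(E/F,\Theta)$ be an admissible pair and, for a nontrivial additive character $\psi$ of $F$, let $\pi_{\Theta,\psi}$ be the associated representation of $GL(2,F)_N=\{g\in GL(2,F)\mid \det g\in N(E^\times)\}$. Put $$\pi_\Theta=\mathrm{Ind}_{GL(2,F)_N}^{GL(2,F)}\pi_{\Theta,\psi}.$$ Then $\pi_\Theta$ is an irreducible representation of $GL(2,F)$, and it is independent of $\psi$: for any two nontrivial additive characters $\psi,\psi'$ of $F$, one has $\mathrm{Ind}_{GL(2,F)_N}^{GL(2,F)}\pi_{\Theta,\psi}\cong \mathrm{Ind}_{GL(2,F)_N}^{GL(2,F)}\pi_{\Theta,\psi'}$.
   Context: $F$ is a non-Archimedean local field of characteristic $0$ with normalized absolute value $|\cdot|$. $E=F(\delta)$, $\delta=\sqrt{\Delta}$, is a tamely ramified quadratic field extension of $F$, where $\Delta\in F^\times$ is a non-square. Let $\sigma$ be the nontrivial element of $\mathrm{Gal}(E/F)$, also written $\alpha^\sigma=\sigma(\alpha)$; $N=N_{E/F}$ and $\mathrm{Tr}=\mathrm{Tr}_{E/F}$ are the norm and trace; $E^1=\{\mu\in E\mid N(\mu)=1\}$. $(\cdot,\cdot)$ is the quadratic Hilbert symbol of $F$, so $x\mapsto (x,\Delta)$ is the character of $F^\times$ with kernel $N(E^\times)$. Admissible pair: a pair $(E/F,\Theta)$ with $E=F(\sqrt{\Delta})$ a tamely ramified quadratic field extension of $F$ ($\Delta\in F^\times$ a non-square) and $\Theta$ a (smooth, complex-valued) character of $E^\times$ such that (1) $\Theta$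 does not factor through $N:E^\times\to F^\times$; and (2) if $\Theta|_{U_E^1}$ factors through $N$, then $E/F$ is unramified, where $U_E^1=1+\mathfrak p_E$ and $\mathfrak p_E$ is the maximal ideal of the valuation ring of $E$. Put $\theta=\Theta|_{E^1}$. $\psi$ is a nontrivial additive character of $F$ and $\psi_E=\psi\circ\mathrm{Tr}$. $\mathcal S(E)$ is the space of locally constant compactly supported functions $E\to\mathbb C$, and $$\mathcal S(E)_\theta=\{\varphi\in\mathcal S(E)\mid \varphi(\alpha\mu)=\theta(\mu)\varphi(\alpha)\ \forall \mu\in E^1,\ \alpha\in E\}.$$ For $\varphi\in \mathcal S(E)$ let $\hat\varphi(\alpha)=\int_E\psi_E(z\alpha^\sigma)\varphi(z)\,dz$, with $dz$ the Haar measure self-dual with respect to the pairing $(z,\alpha)\mapsto\psi_E(z\alpha^\sigma)$. Let $\lambda(\psi)$ be the Weil index of $\alpha\mapsto\psi(N(\alpha))$ on $E$, i.e. the eventually constant value of $\int_{\mathfrak p_E^{-n}}\psi(N(z))\,dz$ for large $n$ (a complex number of modulus one). $\pi_{\theta,\psi}$ is the representation of $SL(2,F)$ on $\mathcal S(E)_\theta$ determined by $$\pi_{\theta,\psi}\begin{bmatrix} a&0\\0&a^{-1}\end{bmatrix}\varphi(\alpha)=(a,\Delta)|a|\varphi(a\alpha),\quad \pi_{\theta,\psi}\begin{bmatrix}1&b\\0&1\end{bmatrix}\varphi(\alpha)=\psi(bN(\alpha))\varphi(\alpha),\quad \pi_{\theta,\psi}\begin{bmatrix}0&1\\-1&0\end{bmatrix}\varphi(\alpha)=\lambda(\psi)\hat\varphi(\alpha)$$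 for $a\in F^\times$, $b\in F$. $\pi_{\Theta,\psi}$ is the representation of $GL(2,F)_N$ on $\mathcal S(E)_\theta$ given on $SL(2,F)$ by $\pi_{\theta,\psi}$, together with $$\pi_{\Theta,\psi}\begin{bmatrix}\gamma&0\\0&1\end{bmatrix}\varphi(\alpha)=\Theta(\zeta)|\gamma|^{1/2}\varphi(\sigma(\zeta)\alpha)\quad(\gamma\in N(E^\times),\ \zeta\in E^\times \text{ any element with } N(\zeta)=\gamma),$$ $$\pi_{\Theta,\psi}\begin{bmatrix}x&0\\0&x\end{bmatrix}\varphi(\alpha)=(x,\Delta)\Theta(x)\varphi(\alpha)\quad (x\in F^\times).$$ The formula for $\gamma$ does not depend on the choice of $\zeta$. *)

(* Defs.v *)
From HB Require Import structures.
From mathcomp Require Import all_boot all_order all_algebra all_fingroup all_field.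
From mathcomp Require Import complex.
From mathcomp Require Import all_classical all_reals all_analysis.

Set Implicit Arguments.
Unset Strict Implicit.
Unset Printing Implicit Defensive.

Import Order.TTheory GRing.Theory Num.Theory.

Local Open Scope classical_set_scope.
Local Open Scope ring_scope.
Local Open Scope complex_scope.

(* A field K with an absolute value abs is viewed as a topological and as a
   Borel space through the aliases adic abs and borel abs of K. *)

Definition adic (R : realType) (K : fieldType) (abs : K -> R) : Type := K.

Section AdicTopology.
Variables (R : realType) (K : fieldType) (abs : K -> R).

HB.instance Definition _ := Choice.on (adic abs).
HB.instance Definition _ := isPointed.Build (adic abs) (0 : K).

Definition adic_open : set_system (adic abs) :=
  [set U | forall x : K, U x ->
     exists2 e : R, 0 < e & forall y : K, abs (y - x) < e -> U y].

Let adic_openT : adic_open setT.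
Proof. by move=> x _; exists 1. Qed.

Let adic_openI : setI_closed adic_open.
Proof.
move=> A B oA oB x [Ax Bx].
have [e e0 eA] := oA x Ax; have [d d0 dB] := oB x Bx.
exists (Num.min e d); first by rewrite lt_min e0.
by move=> y; rewrite lt_min => /andP[ye yd]; split; [exact: eA|exact: dB].
Qed.

Let adic_open_bigU (I : Type) (f : I -> set (adic abs)) :
  (forall i, adic_open (f i)) -> adic_open (\bigcup_i f i).
Proof.
move=> of_ x [i _ fix_]; have [e e0 ef] := of_ i x fix_.
by exists e => // y ye; exists i => //; exact: ef.
Qed.

HB.instance Definition _ :=
  isOpenTopological.Build (adic abs) adic_openT adic_openI adic_open_bigU.

Definition borel := g_sigma_algebraType (@open (adic abs)).

End AdicTopology.

Section LocalField.
Variables (R : realType) (K : fieldType) (abs : K -> R).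

Definition uniformizer (w : K) : Prop :=
  [/\ w != 0, abs w < 1 & forall x, abs x < 1 -> abs x <= abs w].

Definition residue_system (s : seq K) : Prop :=
  [/\ uniq s, (forall x, x \in s -> abs x <= 1) &
      forall y, abs y <= 1 -> exists! x, x \in s /\ abs (y - x) < 1].

Definition abs_complete : Prop :=
  forall u : nat -> K,
    (forall e : R, 0 < e -> exists N, forall m n, (N <= m)%N -> (N <= n)%N ->
       abs (u m - u n) < e) ->
    exists l : K, forall e : R, 0 < e -> exists N, forall n, (N <= n)%N ->
       abs (u n - l) < e.

(* The last field says that the value group is discrete and nontrivial, that
   the residue field is finite, and that abs is normalized: a uniformizer has
   absolute value 1/q, where q is the cardinality of the residue field. *)
Record local_field : Prop := LocalField {
  lf_abs_ge0 : forall x, 0 <= abs x ;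
  lf_abs_eq0 : forall x, abs x = 0 <-> x = 0 ;
  lf_absM : forall x y, abs (x * y) = abs x * abs y ;
  lf_absD : forall x y, abs (x + y) <= Num.max (abs x) (abs y) ;
  lf_complete : abs_complete ;
  lf_normalized : exists w s,
    [/\ uniformizer w, residue_system s & abs w = (size s)%:R^-1] }.

(* Characters of the multiplicative group are functions on K whose value at 0
   is irrelevant. *)
Definition mult_char (chi : K -> R[i]) : Prop :=
  [/\ chi 1 = 1,
      (forall x y, x != 0 -> y != 0 -> chi (x * y) = chi x * chi y) &
      exists2 e : R, 0 < e & forall x, x != 0 -> abs (x - 1) < e -> chi x = 1].

Definition add_char (psi : K -> R[i]) : Prop :=
  [/\ psi 0 = 1,
      (forall x y, psi (x + y) = psi x * psi y) &
      exists2 e : R, 0 < e & forall x, abs x < e -> psi x = 1].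

Definition nontrivial_add_char (psi : K -> R[i]) : Prop :=
  add_char psi /\ exists x, psi x != 1.

Definition schwartz : set (K -> R[i]^o) :=
  [set phi |
     (forall x : adic abs, \forall y \near x, phi y = phi x) /\
     compact (closure [set x : adic abs | phi x != 0])].

Definition haar (mu : {measure set (borel abs) -> \bar R}) : Prop :=
  [/\ (forall (A : set (borel abs)) (x : K), measurable A ->
         mu [set x + y | y in (A : set K)] = mu A),
      (forall A : set (adic abs), compact A -> (mu A < +oo)%E) &
      mu setT <> 0%E].

Definition frac_ideal (n : nat) : set K :=
  [set z | exists2 w, uniformizer w & abs (w ^+ n * z) <= 1].

End LocalField.

Definition cintegral (d : measure_display) (T : measurableType d)
    (R : realType) (mu : {measure set T -> \bar R}) (D : set T)
    (f : T -> R[i]) : R[i] :=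
  Rintegral mu D (fun x => complex.Re (f x))
  +i* Rintegral mu D (fun x => complex.Im (f x)).

Definition hilbert_symbol (F : fieldType) (a b : F) : int :=
  if `[< exists x y z : F, (x, y, z) <> (0, 0, 0) /\
           a * x ^+ 2 + b * y ^+ 2 = z ^+ 2 >] then 1 else -1.

Section NormTrace.
Variables (F : fieldType) (E : splittingFieldType F).

(* galNorm and galTrace are valued in E; descend picks the element of F whose
   image in E is a given element of the base field. *)
Definition descend (y : E) : F := xget 0 [set x : F | x%:A = y].
Definition nrm (a : E) : F := descend (galNorm 1 {:E} a).
Definition trc (a : E) : F := descend (galTrace 1 {:E} a).

Definition norm_group : set F := [set nrm z | z in [set z : E | z != 0]].

(* The normalized absolute value of E is |a|_E = |N(a)|_F. *)
Definition absE (R : realType) (abs : F -> R) (a : E) : R := abs (nrm a).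

End NormTrace.

Section AdmissiblePair.
Variables (R : realType) (F : fieldType) (abs : F -> R).
Variable (E : splittingFieldType F).

Definition ramification_index (e : nat) : Prop :=
  exists (w : F) (v : E),
    [/\ uniformizer abs w, uniformizer (absE abs) v &
        absE abs (w%:A : E) = absE abs v ^+ e].

(* The residue characteristic is the prime p of absolute value < 1. *)
Definition tamely_ramified : Prop :=
  exists2 e, ramification_index e &
    forall p : nat, prime p -> abs p%:R < 1 -> ~~ (p %| e)%N.

Definition unramified : Prop := ramification_index 1.

Definition principal_units : set E := [set u | absE abs (u - 1) < 1].

Definition factors_through_norm (S : set E) (Theta : E -> R[i]) : Prop :=
  exists2 chi : F -> R[i], mult_char abs chi &
    forall z, S z -> Theta z = chi (nrm z).

Definition quadratic_ext (Delta : F) (delta : E) : Prop :=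
  [/\ Delta != 0, (forall x : F, x ^+ 2 <> Delta), delta ^+ 2 = Delta%:A &
      <<1; delta>>%VS = {:E}%VS].

Definition admissible_pair (Delta : F) (delta : E) (Theta : E -> R[i]) : Prop :=
  [/\ quadratic_ext Delta delta, tamely_ramified, mult_char (absE abs) Theta,
      ~ factors_through_norm [set z | z != 0] Theta &
      factors_through_norm principal_units Theta -> unramified].

End AdmissiblePair.

Record GL2 (F : fieldType) :=
  MkGL2 { gl2_mx : 'M[F]_2 ; gl2_unit : gl2_mx \in unitmx }.

Section GL2Group.
Variable F : fieldType.

HB.instance Definition _ := [isSub of GL2 F for @gl2_mx F].
HB.instance Definition _ := [Choice of GL2 F by <:].

Let gl2_one : GL2 F := MkGL2 (unitmx1 F 2).
Let gl2_mul (g h : GL2 F) : GL2 F :=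
  MkGL2 (etrans (unitmx_mul (gl2_mx g) (gl2_mx h))
           (introT andP (conj (gl2_unit g) (gl2_unit h)))).
Let gl2_inv (g : GL2 F) : GL2 F :=
  MkGL2 (etrans (unitmx_inv (gl2_mx g)) (gl2_unit g)).

Let gl2_mulA : associative gl2_mul.
Proof. by move=> x y z; apply: val_inj; rewrite /= mulmxA. Qed.
Let gl2_mul1 : left_id gl2_one gl2_mul.
Proof. by move=> x; apply: val_inj; rewrite /= mul1mx. Qed.
Let gl2_1mul : right_id gl2_one gl2_mul.
Proof. by move=> x; apply: val_inj; rewrite /= mulmx1. Qed.
Let gl2_mulV : left_inverse gl2_one gl2_inv gl2_mul.
Proof. by move=> x; apply: val_inj; rewrite /= mulVmx // gl2_unit. Qed.
Let gl2_Vmul : right_inverse gl2_one gl2_inv gl2_mul.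
Proof. by move=> x; apply: val_inj; rewrite /= mulmxV // gl2_unit. Qed.

HB.instance Definition _ := isGroup.Build (GL2 F)
  gl2_mulA gl2_mul1 gl2_1mul gl2_mulV gl2_Vmul.

Definition mx2 (a b c d : F) : 'M[F]_2 :=
  \matrix_(i, j) if i == 0 then (if j == 0 then a else b)
                 else (if j == 0 then c else d).

End GL2Group.

(* A representation of a subgroup H of G is given by a subspace V of a vector
   space W and operators rho h, of which only the action of h in H on V
   matters. *)
Section Representations.
Variables (C : fieldType) (G : groupType).

Definition subspace (W : lmodType C) (V : set W) : Prop :=
  V 0 /\ forall (a : C) u v, V u -> V v -> V (a *: u + v).

Definition linear_on (W1 W2 : lmodType C) (V : set W1) (T : W1 -> W2) : Prop :=
  forall (a : C) u v, V u -> V v -> T (a *: u + v) = a *: T u + T v.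

Record is_rep (H : set G) (W : lmodType C) (V : set W) (rho : G -> W -> W) :
    Prop := IsRep {
  rep_subspace : subspace V ;
  rep_stable : forall h v, H h -> V v -> V (rho h v) ;
  rep_linear : forall h, H h -> linear_on V (rho h) ;
  rep_one : forall v, V v -> rho 1%g v = v ;
  rep_mul : forall g h v, H g -> H h -> V v ->
    rho (g * h)%g v = rho g (rho h v) }.

Definition irreducible_rep (H : set G) (W : lmodType C) (V : set W)
    (rho : G -> W -> W) : Prop :=
  [/\ is_rep H V rho, (exists2 v, V v & v != 0) &
      forall U : set W, subspace U -> U `<=` V ->
        (forall h u, H h -> U u -> U (rho h u)) ->
        U = [set 0] \/ U = V].

Definition equivalent_rep (H : set G) (W1 W2 : lmodType C)
    (V1 : set W1) (rho1 : G -> W1 -> W1)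
    (V2 : set W2) (rho2 : G -> W2 -> W2) : Prop :=
  exists T : W1 -> W2,
    [/\ set_bij V1 V2 T, linear_on V1 T &
        forall h v, H h -> V1 v -> T (rho1 h v) = rho2 h (T v)].

End Representations.

Section Induction.
Variables (R : realType) (F : fieldType) (abs : F -> R).
Variables (C : fieldType) (W : lmodType C).

(* The sets of g with all |g_ij - delta_ij| < e are a neighbourhood basis of
   the identity, so the last condition is right invariance under an open
   subgroup. *)
Definition Ind (H : set (GL2 F)) (V : set W) (rho : GL2 F -> W -> W) :
    set (GL2 F -> W) :=
  [set f | [/\ (forall g, V (f g)),
               (forall h g, H h -> f (h * g)%g = rho h (f g)) &
               exists2 e : R, 0 < e & forall k : GL2 F,
                 (forall i j, abs (gl2_mx k i j - (i == j)%:R) < e) ->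
                 forall g, f (g * k)%g = f g]].

End Induction.

Definition right_translation (F : fieldType) (W : Type) (g : GL2 F)
    (f : GL2 F -> W) : GL2 F -> W :=
  fun x => f (x * g)%g.

Section WeilRepresentation.
Variables (R : realType) (F : fieldType) (abs : F -> R).
Variables (E : splittingFieldType F) (Delta : F) (sigma : gal_of {:E}).

Definition fourier (mu : {measure set (borel (@absE F E R abs)) -> \bar R})
    (psi : F -> R[i]) (phi : E -> R[i]^o) : E -> R[i]^o :=
  fun a => cintegral mu setT (fun z : E => psi (trc (z * sigma a)) * phi z).

Definition self_dual (mu : {measure set (borel (@absE F E R abs)) -> \bar R})
    (psi : F -> R[i]) : Prop :=
  forall phi, schwartz (absE abs) phi ->
    forall a, fourier mu psi (fourier mu psi phi) a = phi (- a).

Definition weil_index (mu : {measure set (borel (@absE F E R abs)) -> \bar R})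
    (psi : F -> R[i]) : R[i] :=
  xget 0 [set l : R[i] | \forall n \near \oo,
    cintegral mu (frac_ideal (@absE F E R abs) n) (fun z : E => psi (nrm z)) = l].

Definition schwartz_theta (Theta : E -> R[i]) : set (E -> R[i]^o) :=
  [set phi | schwartz (absE abs) phi /\
     forall m a : E, nrm m = 1 -> phi (a * m) = Theta m * phi a].

Definition GL2N : set (GL2 F) := [set g | norm_group E (\det (gl2_mx g))].

Record is_pi_Theta (Theta : E -> R[i]) (psi : F -> R[i])
    (mu : {measure set (borel (@absE F E R abs)) -> \bar R})
    (rho : GL2 F -> (E -> R[i]^o) -> (E -> R[i]^o)) : Prop := IsPiTheta {
  pi_rep : is_rep GL2N (schwartz_theta Theta) rho ;
  pi_torus : forall (a : F) (g : GL2 F) phi (z : E),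
    a != 0 -> gl2_mx g = mx2 a 0 0 a^-1 -> schwartz_theta Theta phi ->
    rho g phi z = (hilbert_symbol a Delta)%:~R * (abs a)%:C * phi (a *: z) ;
  pi_unipotent : forall (b : F) (g : GL2 F) phi (z : E),
    gl2_mx g = mx2 1 b 0 1 -> schwartz_theta Theta phi ->
    rho g phi z = psi (b * nrm z) * phi z ;
  pi_weyl : forall (g : GL2 F) phi (z : E),
    gl2_mx g = mx2 0 1 (-1) 0 -> schwartz_theta Theta phi ->
    rho g phi z = weil_index mu psi * fourier mu psi phi z ;
  pi_norm : forall (zeta : E) (g : GL2 F) phi (z : E),
    zeta != 0 -> gl2_mx g = mx2 (nrm zeta) 0 0 1 -> schwartz_theta Theta phi ->
    rho g phi z =
      Theta zeta * (Num.sqrt (abs (nrm zeta)))%:C * phi (sigma zeta * z) ;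
  pi_central : forall (x : F) (g : GL2 F) phi (z : E),
    x != 0 -> gl2_mx g = mx2 x 0 0 x -> schwartz_theta Theta phi ->
    rho g phi z = (hilbert_symbol x Delta)%:~R * Theta x%:A * phi z }.

(* The Haar measure dz, hence pi_(Theta, psi), is determined by psi. *)
Definition pi_Theta_psi (Theta : E -> R[i]) (psi : F -> R[i])
    (rho : GL2 F -> (E -> R[i]^o) -> (E -> R[i]^o)) : Prop :=
  exists mu : {measure set (borel (@absE F E R abs)) -> \bar R},
    [/\ haar mu, self_dual mu psi & is_pi_Theta Theta psi mu rho].

End WeilRepresentation.

(* Main.v *)
Require Import Defs.
From mathcomp Require Import all_boot all_order all_algebra all_fingroup all_field.
From mathcomp Require Import complex.
From mathcomp Require Import all_classical all_reals all_analysis.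
From mathcomp Require Import ring lra.

(* The restriction of Theta to the norm one group is nontrivial: otherwise Theta
   would factor through the norm. Hence theta-equivariant Schwartz functions
   vanish near 0, and f |-> (x |-> f(diag(x,1))(1)) embeds the induced
   representation into the locally constant functions with compact support in
   the multiplicative group of F, with unipotents acting by multiplication by
   psi(b x) and diag(y,1) by translation. A nonzero subspace of that function
   space which is stable under both contains all of it: sums of the characters
   psi(b x) over residues cut functions down to small balls.

   Every nontrivial psi' is psi(c x) for some c. Conjugating pi_(Theta,psi) by
   diag(c,1) gives a representation which agrees with pi_(Theta,psi') on the upper
   triangular matrices and, by uniqueness of Haar integrals, up to a scalar t at
   the Weyl element w. The relation w u(1) w = - u(-1) w u(-1) forces t^2 = t, so
   t = 1, which avoids computing any Weil index. *)

Set Implicit Arguments.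
Unset Strict Implicit.
Unset Printing Implicit Defensive.
Import Order.TTheory GRing.Theory Num.Theory.
Local Open Scope classical_set_scope.
Local Open Scope ring_scope.

(** * Ultrametric absolute values and local fields *)

(** Irreducibility is tested on the upper triangular matrices alone. The Weyl element enters it only
    in showing that each vector of pi is fixed by an open subgroup; this is not part of the data of
    [rho], and it is what makes the induced space nonzero.

    The embedding by f(diag(x,1))(1) loses nothing although it evaluates at the single point 1 of E:
    diag(N(zeta),1) carries the value at sigma(zeta) to the value at 1, up to a nonzero factor.

    Characteristic 0 enters through square roots. An element x of F close to 1 is a square y^2 =
    N(y) with y close to 1, so its Hilbert symbols are trivial and diag(x,1) acts through z |-> y z.
    Together with the finiteness of the square classes this replaces any appeal to class field
    theory.

    In the last step, w occurs twice on the left of the relation and once on the right, hence t^2 =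
    t; invertibility of w excludes t = 0. *)

Lemma expr_lt_eps (R : realType) (rho e : R) :
  0 <= rho < 1 -> 0 < e -> exists n, forall m, (n <= m)%N -> rho ^+ m < e.
Proof.
move=> /andP[r0 r1] e0.
have : (fun n => rho ^+ n) @ \oo --> (0 : R^o) by apply: cvg_expr; rewrite ger0_norm.
move=> /cvgrPdist_lt /(_ _ e0) [n _ nP]; exists n => m nm.
by have := nP m nm; rewrite /= sub0r normrN ger0_norm // exprn_ge0.
Qed.

(** Completeness and normalization are left out, so that the same lemmas serve F and, once
    [absE_ultrametric] is known, E. *)
Definition ultrametric (R : realType) (K : fieldType) (abs : K -> R) : Prop :=
  [/\ forall x, 0 <= abs x, forall x, abs x = 0 <-> x = 0,
      forall x y, abs (x * y) = abs x * abs y &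
      forall x y, abs (x + y) <= Num.max (abs x) (abs y)].

Section Ultrametric.
Variables (R : realType) (K : fieldType) (abs : K -> R).
Hypothesis ua : ultrametric abs.

Let abs_ge0 x : 0 <= abs x. Proof. by case: ua. Qed.
Let abs_eq0P x : abs x = 0 <-> x = 0. Proof. by case: ua. Qed.
Let absM x y : abs (x * y) = abs x * abs y. Proof. by case: ua. Qed.
Let absD x y : abs (x + y) <= Num.max (abs x) (abs y). Proof. by case: ua. Qed.

Lemma abs_0 : abs 0 = 0. Proof. exact/abs_eq0P. Qed.

Lemma abs_gt0 x : (0 < abs x) = (x != 0).
Proof.
rewrite lt_def abs_ge0 andbT; congr (~~ _).
by apply/eqP/eqP => /abs_eq0P.
Qed.

Lemma abs_1 : abs 1 = 1.
Proof.
have h : abs 1 * abs 1 = abs 1 * 1 by rewrite -absM !mulr1.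
by apply: (mulfI _ h); rewrite gt_eqF // abs_gt0 oner_eq0.
Qed.

Lemma abs_X x n : abs (x ^+ n) = abs x ^+ n.
Proof. by elim: n => [|n IH]; rewrite ?expr0 ?abs_1 // !exprS absM IH. Qed.

Lemma abs_N x : abs (- x) = abs x.
Proof.
have h : abs (-1) = 1.
  apply/eqP; rewrite -(@eqrXn2 _ 2) ?abs_ge0 //.
  by rewrite -abs_X sqrrN !expr1n abs_1.
by rewrite -mulN1r absM h mul1r.
Qed.

Lemma abs_V x : abs x^-1 = (abs x)^-1.
Proof.
have [->|x0] := eqVneq x 0; first by rewrite invr0 abs_0 invr0.
have ax0 : abs x != 0 by rewrite gt_eqF // abs_gt0.
by apply: (mulfI ax0); rewrite -absM !divff // abs_1.
Qed.

Lemma abs_B x y : abs (x - y) = abs (y - x).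
Proof. by rewrite -abs_N opprB. Qed.

Lemma abs_add_le x y m : abs x <= m -> abs y <= m -> abs (x + y) <= m.
Proof. by move=> xm ym; rewrite (le_trans (absD _ _)) // ge_max xm. Qed.

Lemma abs_sub_le x y m : abs x <= m -> abs y <= m -> abs (x - y) <= m.
Proof. by move=> xm ym; rewrite abs_add_le // abs_N. Qed.

Lemma abs_add_lt x y m : abs x < m -> abs y < m -> abs (x + y) < m.
Proof. by move=> xm ym; rewrite (le_lt_trans (absD _ _)) // gt_max xm. Qed.

Lemma abs_sub_lt x y m : abs x < m -> abs y < m -> abs (x - y) < m.
Proof. by move=> xm ym; rewrite abs_add_lt // abs_N. Qed.

Lemma abs_dist_le y x z m : abs (x - y) <= m -> abs (y - z) <= m -> abs (x - z) <= m.
Proof. by move=> xm ym; rewrite -(subrKA y) abs_add_le. Qed.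

Lemma abs_dist_lt y x z m : abs (x - y) < m -> abs (y - z) < m -> abs (x - z) < m.
Proof. by move=> xm ym; rewrite -(subrKA y) abs_add_lt. Qed.

Lemma abs_near x y : abs (x - y) < abs y -> abs x = abs y.
Proof.
move=> h; apply/eqP; rewrite eq_le; apply/andP; split.
  by rewrite -(subrK y x) abs_add_le // ltW.
rewrite leNgt; apply/negP => xy.
have : abs (x - (x - y)) < abs y by apply: abs_sub_lt.
by rewrite opprB addrC subrK ltxx.
Qed.

Lemma abs_near1 x : abs (x - 1) < 1 -> abs x = 1.
Proof. by have := @abs_near x 1; rewrite abs_1. Qed.

Lemma near1_neq0 x : abs (x - 1) < 1 -> x != 0.
Proof. by move=> /abs_near1 h; rewrite -abs_gt0 h. Qed.

Lemma near1_mul x y e : e <= 1 -> abs (x - 1) < e -> abs (y - 1) < e ->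
  abs (x * y - 1) < e.
Proof.
move=> e1 xe ye.
have -> : x * y - 1 = x * (y - 1) + (x - 1) by ring.
by rewrite abs_add_lt // absM (abs_near1 (lt_le_trans xe e1)) mul1r.
Qed.

Lemma near1_inv x e : e <= 1 -> abs (x - 1) < e -> abs (x^-1 - 1) < e.
Proof.
move=> e1 xe; have x1 := lt_le_trans xe e1.
have x0 := near1_neq0 x1.
have -> : x^-1 - 1 = - (x^-1 * (x - 1)) by field.
by rewrite abs_N absM abs_V abs_near1 // invr1 mul1r.
Qed.

Lemma abs_nat n : abs n%:R <= 1.
Proof.
elim: n => [|n IH]; first by rewrite abs_0 ler01.
by rewrite -natr1 abs_add_le // abs_1.
Qed.

(** By the ultrametric inequality the distance from u n to any later term is bounded by the largest
    single step, so the limit inherits the rate with the same constant C. *)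
Lemma geometric_limit (u : nat -> K) (C rho : R) :
  abs_complete abs -> 0 <= rho < 1 ->
  (forall n, abs (u n.+1 - u n) <= C * rho ^+ n) ->
  exists l, forall n, abs (l - u n) <= C * rho ^+ n.
Proof.
move=> cpl rho01 hu.
have /andP[r0 r1] := rho01.
have C0 : 0 <= C by have := le_trans (abs_ge0 _) (hu 0%N); rewrite expr0 mulr1.
have mono n k : rho ^+ (n + k) <= rho ^+ n.
  by rewrite exprD ler_piMr ?exprn_ge0 // exprn_ile1 // ltW.
have far n k : abs (u (n + k)%N - u n) <= C * rho ^+ n.
  elim: k => [|k IH]; first by rewrite addn0 subrr abs_0 mulr_ge0 ?exprn_ge0.
  rewrite addnS; apply: abs_dist_le IH.
  by apply: le_trans (hu _) _; rewrite ler_wpM2l.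
have [e e0|l hl] := cpl u.
  have [N hN] := expr_lt_eps rho01 (divr_gt0 e0 (ltr_wpDl C0 ltr01)).
  have Ne n : (N <= n)%N -> abs (u n - u N) < e.
    move=> /subnKC <-; apply: le_lt_trans (far _ _) _.
    have := hN N (leqnn _); rewrite ltr_pdivlMr ?ltr_wpDl // => h.
    apply: le_lt_trans h; rewrite mulrC ler_wpM2l ?exprn_ge0 //.
    by rewrite lerDl.
  exists N => m n Nm Nn; apply: (@abs_dist_lt (u N)); first exact: Ne.
  by rewrite abs_B; exact: Ne.
exists l => n; rewrite leNgt; apply/negP => h.
have [N hN] := hl _ (le_lt_trans (mulr_ge0 C0 (exprn_ge0 n r0)) h).
have := hN (n + N)%N (leq_addl _ _); rewrite (abs_B _ l) => h1.
have : abs (l - u n) < abs (l - u n); last by rewrite ltxx.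
by have := abs_dist_lt h1 (le_lt_trans (far n N) h); rewrite ltxx.
Qed.
End Ultrametric.

Lemma local_field_ultrametric (R : realType) (F : fieldType) (abs : F -> R) :
  local_field abs -> ultrametric abs.
Proof. by case=> ? ? ? ?; split. Qed.

Section LocalFieldTheory.
Variables (R : realType) (F : fieldType) (abs : F -> R).
Hypothesis lf : local_field abs.
Let ua := local_field_ultrametric lf.
Let absM := lf_absM lf.
Let abs_ge0 := lf_abs_ge0 lf.

Lemma exists_uniformizer : exists w, uniformizer abs w.
Proof. by have [w [s [uw _ _]]] := lf_normalized lf; exists w. Qed.

Lemma uniformizer_abs w : uniformizer abs w -> 0 < abs w < 1.
Proof. by case=> w0 w1 _; rewrite (abs_gt0 ua) w0 w1. Qed.

Lemma uniformizer_lt w x y : uniformizer abs w -> abs x < abs y ->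
  abs x <= abs y * abs w.
Proof.
move=> [w0 w1 hw] xy; have y0 : 0 < abs y by rewrite (le_lt_trans _ xy).
have := hw (x / y); rewrite absM (abs_V ua) ltr_pdivrMr // mul1r => /(_ xy).
by rewrite ler_pdivrMr // mulrC.
Qed.

Lemma exists_small e : 0 < e -> exists2 x, x != 0 & abs x < e.
Proof.
move=> e0; have [w uw] := exists_uniformizer.
have /andP[w0 w1] := uniformizer_abs uw.
have [|n /(_ n (leqnn _)) hn] := @expr_lt_eps _ (abs w) e _ e0; first by rewrite ltW.
by exists (w ^+ n); rewrite ?(abs_X ua) // -(abs_gt0 ua) (abs_X ua) exprn_gt0.
Qed.

Lemma exists_large M : exists2 x, x != 0 & M < abs x.
Proof.
have M0 : 0 < Num.max M 1 by rewrite lt_max ltr01 orbT.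
have [x x0 xM] := exists_small (e := (Num.max M 1)^-1) ltac:(by rewrite invr_gt0).
exists x^-1; first by rewrite invr_eq0.
rewrite (abs_V ua) (@le_lt_trans _ _ (Num.max M 1)) //; first by rewrite le_max lexx.
by rewrite -[ltLHS]invrK ltf_pV2 ?posrE ?invr_gt0 ?(abs_gt0 ua).
Qed.

(* Hensel's lemma for a quadratic with dominant linear coefficient: the root
   close to t is the limit of the iteration x |-> t - n / x. *)
Lemma hensel_quadratic t n : abs n <= 1 -> 1 < abs t ->
  exists2 x, abs x = abs t & x ^+ 2 - t * x + n = 0.
Proof.
move=> n1 t1; set rho := (abs t)^-1.
have t0 : 0 < abs t by rewrite (lt_trans _ t1).
have tN0 : t != 0 by rewrite -(abs_gt0 ua).
have rho0 : 0 < rho by rewrite invr_gt0.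
have rho1 : rho < 1 by rewrite invf_lt1.
have rho01 : 0 <= rho < 1 by rewrite ltW.
pose u k := iter k (fun x => t - n / x) t.
(* Since |n| <= 1 < |t|, all iterates stay on the sphere |x| = |t|, where the map contracts by the
   factor [rho]. *)
have step x : abs x = abs t -> abs (t - n / x) = abs t.
  move=> xt; apply: (abs_near ua).
  rewrite addrAC subrr sub0r (abs_N ua) absM (abs_V ua) xt.
  by rewrite ltr_pdivrMr // (le_lt_trans n1) // (lt_le_trans t1) // ler_peMr // ltW.
have ut k : abs (u k) = abs t by elim: k => //= k; exact: step.
have contr x y : abs x = abs t -> abs y = abs t ->
    abs ((t - n / x) - (t - n / y)) <= rho * abs (x - y).
  move=> xt yt.
  have x0 : x != 0 by rewrite -(abs_gt0 ua) xt.
  have y0 : y != 0 by rewrite -(abs_gt0 ua) yt.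
  have -> : (t - n / x) - (t - n / y) = n * (x^-1 * (y^-1 * (x - y))) by field; rewrite x0 y0.
  rewrite !absM !(abs_V ua) xt yt -/rho.
  rewrite (mulrA (abs n)).
  by rewrite ler_piMl ?mulr_ge0 ?abs_ge0 ?(ltW rho0) // mulr_ile1 ?abs_ge0 ?(ltW rho0) ?(ltW rho1).
have rate k : abs (u k.+1 - u k) <= 1 * rho ^+ k.
  elim: k => [|k IH].
    rewrite /= addrAC subrr sub0r (abs_N ua) absM (abs_V ua) -/rho expr0.
    by rewrite mul1r mulr_ile1 ?abs_ge0 ?(ltW rho0) ?(ltW rho1).
  apply: le_trans (contr _ _ (ut k.+1) (ut k)) _.
  by rewrite exprS mul1r ler_wpM2l ?(ltW rho0) // -[leRHS]mul1r.
have [l hl] := geometric_limit ua (lf_complete lf) rho01 rate.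
have lt : abs l = abs t.
  apply: (abs_near ua); have := hl 0%N; rewrite /= expr0 mulr1 => h.
  exact: le_lt_trans h t1.
have l0 : l != 0 by rewrite -(abs_gt0 ua) lt.
exists l => //.
have -> : l ^+ 2 - t * l + n = l * (l - (t - n / l)) by field.
suff -> : l - (t - n / l) = 0 by rewrite mulr0.
apply/eqP; rewrite -[_ == _]negbK -(abs_gt0 ua); apply/negP => d0.
have [N hN] := expr_lt_eps rho01 d0.
have : abs (l - (t - n / l)) <= rho ^+ N.
  apply: (abs_dist_le ua (y := u N.+1)).
    apply: le_trans (hl N.+1) _.
    by rewrite mul1r exprS ler_piMl ?exprn_ge0 ?(ltW rho0) ?(ltW rho1).
  apply: le_trans (contr _ _ (ut N) lt) _.
  rewrite (abs_B ua) -[leRHS]mul1r ler_pM ?(ltW rho0) ?(ltW rho1) ?abs_ge0 //.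
  by rewrite -[leRHS]mul1r.
by rewrite leNgt hN.
Qed.

(* With x = 1 + 4 h, y = +-(1 + 2 s) is a square root when s^2 + s = h; scaling
   s = Y / c with |c| > 1 puts this equation in the form of hensel_quadratic. *)
Lemma sqrt_near1 e : [pchar F] =i pred0 -> 0 < e ->
  exists2 d, 0 < d & forall x, abs (x - 1) < d ->
    exists2 y, y ^+ 2 = x & abs (y - 1) < e.
Proof.
move=> ch0 e0; have [c c0 c1] := exists_large 1.
have two0 : (2 : F) != 0 by rewrite ((pcharf0P _).1 ch0).
have four0 : (4 : F) != 0 by rewrite ((pcharf0P _).1 ch0).
have a4 : 0 < abs 4 by rewrite (abs_gt0 ua).
have ac : 0 < abs c by rewrite (abs_gt0 ua).
exists (Num.min (e * abs 4) (abs 4 / abs c ^+ 2)).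
  by rewrite lt_min mulr_gt0 // divr_gt0 // exprn_gt0.
move=> x; rewrite lt_min => /andP[x1 x2].
set h := (x - 1) / 4.
have ah : abs h = abs (x - 1) / abs 4 by rewrite absM (abs_V ua).
have [||Y Yc Ye] := @hensel_quadratic (- c) (- (c ^+ 2 * h)).
- rewrite (abs_N ua) absM (abs_X ua) ah.
  rewrite mulrC -mulrA; move: x2; rewrite ltr_pdivlMr ?exprn_gt0 // => x2.
  by rewrite [_^-1 * _]mulrC mulrA ler_pdivrMr // mul1r ltW.
- by rewrite (abs_N ua).
have sE : (Y / c) ^+ 2 + Y / c = h.
  apply: (mulfI (expf_neq0 2 c0)).
  have -> : c ^+ 2 * ((Y / c) ^+ 2 + Y / c) = Y ^+ 2 - - c * Y by field.
  by apply/eqP; rewrite -subr_eq0 Ye.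
have as1 : abs (Y / c) = 1 by rewrite absM (abs_V ua) Yc (abs_N ua) divff // gt_eqF.
(* Hensel's lemma gives the root s = Y / c with |s| = 1. As s (s + 1) = h is small, s is close to
   -1, so the square root close to 1 is - (1 + 2 s). *)
exists (- (1 + 2 * (Y / c))).
  have -> : (- (1 + 2 * (Y / c))) ^+ 2 = 1 + 4 * ((Y / c) ^+ 2 + Y / c) by ring.
  by rewrite sE /h; field.
have -> : - (1 + 2 * (Y / c)) - 1 = - (2 * (1 + Y / c)) by ring.
rewrite (abs_N ua) absM; apply: (@le_lt_trans _ _ (abs h)).
  rewrite -sE (_ : _ ^+ 2 + _ = (1 + Y / c) * (Y / c)); last by ring.
  by rewrite (absM (1 + _)) as1 mulr1 ler_piMl ?abs_ge0 ?(abs_nat ua).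
by rewrite ah ltr_pdivrMr.
Qed.

End LocalFieldTheory.

(** * Quadratic extensions *)

Section QuadraticExtension.
Variables (F : fieldType) (E : splittingFieldType F) (Delta : F) (delta : E).
Variable sigma : gal_of {:E}.
Hypotheses (ch0 : [pchar F] =i pred0) (qe : quadratic_ext Delta delta).
Hypotheses (sG : sigma \in 'Gal({:E} / 1)%g) (sigma1 : sigma != 1%g).

Let delta2 : delta ^+ 2 = Delta%:A. Proof. by case: qe. Qed.

Lemma algA_inj : injective (fun x : F => x%:A : E).
Proof.
move=> x y /eqP; rewrite -subr_eq0 -scalerBl scaler_eq0 oner_eq0 orbF subr_eq0.
by move/eqP.
Qed.

Lemma quadratic_coords (z : E) : exists x y : F, z = x%:A + y *: delta.
Proof.
have : z \in <<1; delta>>%VS by case: qe => _ _ _ ->; rewrite memvf.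
move/Fadjoin_polyP => [p + ->] {z}; elim/poly_ind: p => [|p c IH] pO.
  by exists 0, 0; rewrite horner0 !scale0r addr0.
have c1 : c \in 1%VS.
  by have /polyOverP/(_ 0%N) := pO; rewrite coefD coefC coefMX /= add0r.
have pO' : p \in polyOver 1%VS.
  apply/polyOverP => i; have /polyOverP/(_ i.+1) := pO.
  by rewrite coefD coefC coefMX /= addr0.
have [x [y e]] := IH pO'; have /vlineP[k ->] := c1.
exists (y * Delta + k), x; rewrite hornerMXaddC e mulrDl mulr_algl -scalerAl -expr2.
by rewrite delta2 scalerA scalerDl -addrA addrC.
Qed.

Lemma gal_scale (s : gal_of {:E}) (x : F) z : s (x *: z) = x *: s z.
Proof. exact: linearZ. Qed.

Lemma gal_alg (s : gal_of {:E}) (x : F) : s x%:A = x%:A.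
Proof. by rewrite gal_scale rmorph1. Qed.

Lemma gal_delta (s : gal_of {:E}) : s delta = delta \/ s delta = - delta.
Proof.
have /orP[] : (s delta == delta) || (s delta == - delta).
  by rewrite -eqf_sqr -rmorphXn /= delta2 gal_alg.
- by move/eqP; left.
- by move/eqP; right.
Qed.

Lemma gal_fix_delta (s : gal_of {:E}) : s delta = delta -> s = 1%g.
Proof.
move=> sd; apply/eqP/gal_eqP => z _; have [x [y ->]] := quadratic_coords z.
by rewrite !rmorphD /= !gal_alg !gal_scale sd gal_id.
Qed.

Lemma sigma_delta : sigma delta = - delta.
Proof.
by have [/gal_fix_delta e|//] := gal_delta sigma; move: sigma1; rewrite e eqxx.
Qed.

Lemma sigma_coords (x y : F) : sigma (x%:A + y *: delta) = x%:A - y *: delta.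
Proof. by rewrite rmorphD /= gal_alg gal_scale sigma_delta scalerN. Qed.

Lemma sigmaK : involutive sigma.
Proof.
move=> z; have [x [y ->]] := quadratic_coords z.
by rewrite !sigma_coords -scaleNr sigma_coords scaleNr opprK.
Qed.

Lemma quadratic_gal : 'Gal({:E} / 1)%g = [set 1%g; sigma]%SET.
Proof.
apply/setP => s; rewrite !inE; apply/idP/orP => [_|[/eqP->|/eqP->]]; last 2 first.
- exact: group1.
- exact: sG.
have [/gal_fix_delta ->|sd] := gal_delta s; first by left.
right; apply/gal_eqP => z _; have [x [y ->]] := quadratic_coords z.
by rewrite sigma_coords rmorphD /= gal_alg gal_scale sd scalerN.
Qed.

Lemma quadratic_nrm_coords (x y : F) :
  galNorm 1 {:E} (x%:A + y *: delta) = (x ^+ 2 - Delta * y ^+ 2)%:A.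
Proof.
rewrite /galNorm quadratic_gal big_setU1 ?inE 1?eq_sym // big_set1 gal_id.
rewrite sigma_coords /= [LHS]mulrC -subr_sqr (exprZn y) delta2 scalerA scalerBl.
by rewrite (expr2 x%:A) mulr_algl scalerA -expr2 (mulrC Delta).
Qed.

Lemma quadratic_trc_coords (x y : F) :
  galTrace 1 {:E} (x%:A + y *: delta) = (2 * x)%:A.
Proof.
rewrite /galTrace quadratic_gal big_setU1 ?inE 1?eq_sym // big_set1 gal_id.
by rewrite sigma_coords /= addrACA subrr addr0 -scalerDl -mulr2n mulr_natl.
Qed.

Lemma descend_alg (x : F) : descend (x%:A : E) = x.
Proof.
rewrite /descend; case: xgetP => [y _ /= /algA_inj ->//|/(_ x)]; by case.
Qed.

Lemma nrm_coords (x y : F) : nrm (x%:A + y *: delta) = x ^+ 2 - Delta * y ^+ 2.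
Proof. by rewrite /nrm quadratic_nrm_coords descend_alg. Qed.

Lemma trc_coords (x y : F) : trc (x%:A + y *: delta) = 2 * x.
Proof. by rewrite /trc quadratic_trc_coords descend_alg. Qed.

Lemma nrmE (z : E) : (nrm z)%:A = z * sigma z.
Proof.
have [x [y ->]] := quadratic_coords z; rewrite nrm_coords -quadratic_nrm_coords.
by rewrite /galNorm quadratic_gal big_setU1 ?inE 1?eq_sym // big_set1 gal_id /=.
Qed.

Lemma trcE (z : E) : (trc z)%:A = z + sigma z.
Proof.
have [x [y ->]] := quadratic_coords z; rewrite trc_coords -(quadratic_trc_coords _ y).
by rewrite /galTrace quadratic_gal big_setU1 ?inE 1?eq_sym // big_set1 gal_id.
Qed.

Lemma nrmM (z t : E) : nrm (z * t) = nrm z * nrm t.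
Proof.
apply: algA_inj; rewrite /= nrmE rmorphM mulrACA -!nrmE.
by rewrite -scalerAl mul1r scalerA.
Qed.

Lemma nrm_alg (x : F) : nrm (x%:A : E) = x ^+ 2.
Proof. by have := nrm_coords x 0; rewrite scale0r addr0 expr0n mulr0 subr0. Qed.

Lemma nrm1 : nrm (1 : E) = 1.
Proof. by have := nrm_alg 1; rewrite scale1r expr1n. Qed.

Lemma nrmZ (x : F) (z : E) : nrm (x *: z) = x ^+ 2 * nrm z.
Proof. by rewrite -mulr_algl nrmM nrm_alg. Qed.

Lemma nrm_eq0 (z : E) : (nrm z == 0) = (z == 0).
Proof.
rewrite -(inj_eq algA_inj) /= nrmE scale0r mulf_eq0 fmorph_eq0.
by rewrite orbb.
Qed.

Lemma nrm_sigma (z : E) : nrm (sigma z) = nrm z.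
Proof. by apply: algA_inj; rewrite /= !nrmE sigmaK mulrC. Qed.

Lemma nrmV (z : E) : nrm z^-1 = (nrm z)^-1.
Proof.
have [->|z0] := eqVneq z 0.
  by have /eqP := nrm_eq0 0; rewrite eqxx invr0 => /eqP/eqP ->; rewrite invr0.
have n0 : nrm z != 0 by rewrite nrm_eq0.
by apply: (mulfI n0); rewrite -nrmM !divff // nrm1.
Qed.

Lemma trcD (z t : E) : trc (z + t) = trc z + trc t.
Proof. by apply: algA_inj; rewrite /= scalerDl !trcE rmorphD addrACA. Qed.

Lemma trcZ (x : F) (z : E) : trc (x *: z) = x * trc z.
Proof. by apply: algA_inj; rewrite /= -scalerA !trcE gal_scale scalerDr. Qed.

Lemma nrm1D (z : E) : nrm (1 + z) = 1 + trc z + nrm z.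
Proof.
apply: algA_inj; rewrite /= !scalerDl !nrmE trcE rmorphD rmorph1 scale1r.
by ring.
Qed.

Section Absolute.
Variables (R : realType) (abs : F -> R).
Hypothesis lf : local_field abs.
Let ua := local_field_ultrametric lf.

(* If |Tr z| > 1 >= |N z|, Hensel's lemma puts z in F, and then |Tr z| = |2 z| <= 1. *)
Lemma trc_integral (z : E) : abs (nrm z) <= 1 -> abs (trc z) <= 1.
Proof.
move=> nz; rewrite leNgt; apply/negP => tz.
have [x _ xE] := hensel_quadratic lf nz tz.
have : (x%:A - z) * (x%:A - sigma z) = 0 :> E.
  have -> : (x%:A - z) * (x%:A - sigma z) =
    x%:A ^+ 2 - (z + sigma z) * x%:A + z * sigma z by ring.
  rewrite -nrmE -trcE -(scale0r 1) -xE !scalerDl scaleNr.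
  by rewrite mulr_algl scalerA expr2 mulr_algl scalerA -expr2.
move/eqP; rewrite mulf_eq0 !subr_eq0 => h.
have {}h : z = x%:A.
  by case/orP: h => [/eqP->//|/eqP h]; rewrite -(sigmaK z) -h gal_alg.
move: nz tz; rewrite h nrm_alg -[x%:A]addr0 -(scale0r delta) trc_coords.
rewrite (abs_X ua) (lf_absM lf) => nx; apply/negP; rewrite -leNgt.
have x1 : abs x <= 1 by rewrite -(@expr_le1 _ 2) ?(lf_abs_ge0 lf).
by rewrite mulr_ile1 ?(lf_abs_ge0 lf) ?(abs_nat ua).
Qed.

(** Dividing by the larger term reduces the inequality to |1 + z| <= 1 for |z| <= 1. There N(1 + z)
    = 1 + Tr z + N z, and the trace is integral by [trc_integral]. *)
Lemma absE_ultrametric : ultrametric (@absE F E R abs).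
Proof.
have M x y : absE abs (x * y : E) = absE abs x * absE abs y.
  by rewrite /absE nrmM (lf_absM lf).
have eq0 x : absE abs (x : E) = 0 <-> x = 0.
  rewrite /absE; split => [/(lf_abs_eq0 lf)/eqP|->].
    by rewrite nrm_eq0 => /eqP.
  by apply/(lf_abs_eq0 lf)/eqP; rewrite nrm_eq0.
have ge0 x : 0 <= absE abs (x : E) by rewrite /absE; exact: (lf_abs_ge0 lf).
have one (z : E) : absE abs z <= 1 -> absE abs (1 + z) <= 1.
  move=> z1; rewrite /absE nrm1D (abs_add_le ua) //.
  by rewrite (abs_add_le ua) ?(abs_1 ua) ?trc_integral.
have le (x y : E) : absE abs x <= absE abs y -> absE abs (x + y) <= absE abs y.
  move=> xy; have [y0|y0] := eqVneq y 0.
    by move: xy; rewrite y0 addr0.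
  have ay : 0 < absE abs y by rewrite lt_def ge0 andbT; apply/eqP => /eq0/eqP; apply/negP.
  have -> : x + y = (1 + x / y) * y by field.
  rewrite M ler_piMl ?ge0 // one // /absE nrmM nrmV (lf_absM lf) (abs_V ua).
  by rewrite ler_pdivrMr ?mul1r.
split=> // x y; rewrite le_max.
have [xy|/ltW yx] := leP (absE abs x) (absE abs y); first by rewrite le ?orbT.
by rewrite addrC le.
Qed.

Let uaE := absE_ultrametric.

Lemma absE_alg (x : F) : absE abs (x%:A : E) = abs x ^+ 2.
Proof. by rewrite /absE nrm_alg (abs_X ua). Qed.

Lemma absE_scale (x : F) (z : E) : absE abs (x *: z) = abs x ^+ 2 * absE abs z.
Proof. by rewrite /absE nrmZ (lf_absM lf) (abs_X ua). Qed.

Lemma absE_sigma (z : E) : absE abs (sigma z) = absE abs z.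
Proof. by rewrite /absE nrm_sigma. Qed.

Lemma abs_trc (z : E) : abs (trc z) ^+ 2 <= absE abs z.
Proof.
by rewrite -absE_alg trcE (abs_add_le uaE) ?absE_sigma.
Qed.

Let two0 : (2 : F) != 0. Proof. by rewrite ((pcharf0P _).1 ch0). Qed.

(** The coordinates are recovered from 2 x = z + sigma z and 2 y delta = z - sigma z. These bounds
    transport total boundedness and completeness from F to E. *)
Lemma abs_coord1 (x y : F) :
  abs x ^+ 2 <= absE abs (x%:A + y *: delta) / abs 2 ^+ 2.
Proof.
rewrite ler_pdivlMr ?exprn_gt0 ?(abs_gt0 ua) // -exprMn -(lf_absM lf) mulrC.
by rewrite -(trc_coords x y) abs_trc.
Qed.

Lemma abs_coord2 (x y : F) :
  abs y ^+ 2 <= absE abs (x%:A + y *: delta) / (abs 2 ^+ 2 * absE abs delta).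
Proof.
have d0 : delta != 0.
  apply/eqP => d0; case: qe => D0 _ + _; rewrite d0 expr0n /= => /esym/eqP.
  by rewrite scaler_eq0 oner_eq0 orbF; apply/negP.
rewrite ler_pdivlMr ?mulr_gt0 ?exprn_gt0 ?(abs_gt0 uaE) ?(abs_gt0 ua) //.
rewrite mulrA -exprMn -(lf_absM lf) (mulrC y) -absE_scale.
have -> : (2 * y) *: delta = (x%:A + y *: delta) - sigma (x%:A + y *: delta).
  by rewrite sigma_coords opprB addrC addrA subrK -scalerDl mulr_natl mulr2n.
by rewrite (abs_sub_le uaE) // absE_sigma.
Qed.

End Absolute.
End QuadraticExtension.

(** * Compactness *)

(** Finite covers by centres, in place of compactness: this form passes from F to E coordinate by
    coordinate, and it is also what splits Haar integrals into finite sums. *)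
Definition totally_bounded (R : realType) (K : fieldType) (abs : K -> R) : Prop :=
  forall M e, 0 < e -> exists X : seq K, forall x, abs x <= M ->
    exists2 c, c \in X & abs (x - c) < e.

Section LocalFieldCovers.
Variables (R : realType) (F : fieldType) (abs : F -> R).
Hypothesis lf : local_field abs.
Let ua := local_field_ultrametric lf.

Lemma local_field_totally_bounded : totally_bounded abs.
Proof.
move=> M e e0; have [t t0 tM] := exists_large lf M.
have [w [s [uw [_ s1 s2] _]]] := lf_normalized lf.
have [w0 w1 w2] := uw; have /andP[aw0 aw1] := uniformizer_abs lf uw.
have at0 : 0 < abs t by rewrite (abs_gt0 ua).
have [N hN] : exists N, abs (t * w ^+ N) < e.
  have [||N /(_ N (leqnn _)) h] := @expr_lt_eps _ (abs w) (e / abs t).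
  - by rewrite ltW.
  - by rewrite divr_gt0.
  by exists N; rewrite (lf_absM lf) (abs_X ua) mulrC -ltr_pdivlMr.
suff [X hX] : exists X : seq F, forall x, abs x <= abs t ->
    exists2 c, c \in X & abs (x - c) <= abs (t * w ^+ N).
  exists X => x xM; have [|c cX h] := hX x; first by rewrite (le_trans xM) ?ltW.
  by exists c => //; exact: le_lt_trans h hN.
elim: N {hN} => [|n [X hX]].
  by exists [:: 0] => x xt; exists 0; rewrite ?inE // subr0 expr0 mulr1.
(* One more digit r of the w-adic expansion refines every centre. *)
exists [seq c + t * w ^+ n * r | c <- X, r <- s] => x xt.
have [c cX h] := hX x xt.
have tw0 : t * w ^+ n != 0 by rewrite mulf_neq0 // expf_neq0.
have [|r [[rs hr] _]] := s2 ((x - c) / (t * w ^+ n)).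
  by rewrite (lf_absM lf) (abs_V ua) ler_pdivrMr ?(abs_gt0 ua) // mul1r.
exists (c + t * w ^+ n * r); first by apply/allpairsP; exists (c, r).
have -> : x - (c + t * w ^+ n * r) = t * w ^+ n * ((x - c) / (t * w ^+ n) - r).
  by field; rewrite t0 expf_neq0.
rewrite exprSr mulrA !(lf_absM lf (t * _)) ler_pM2l ?(abs_gt0 ua) //.
exact: w2.
Qed.

(** Away from 0 the additive radius r * a is at most the relative radius r, so finitely many cosets
    of a neighbourhood of 1 suffice. *)
Lemma annulus_cover a M r : 0 < a -> 0 < r <= 1 -> exists X : seq F,
  forall x, a <= abs x <= M -> exists c, [/\ c \in X, c != 0 & abs (x / c - 1) < r].
Proof.
move=> a0 /andP[r0 r1].
have [X hX] := local_field_totally_bounded M (mulr_gt0 r0 a0).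
exists X => x /andP[ax xM]; have [c cX h] := hX x xM.
have h1 : abs (x - c) < r * abs x by rewrite (lt_le_trans h) // ler_pM2l.
have cx : abs c = abs x.
  apply: (abs_near ua); rewrite (abs_B ua) (lt_le_trans h1) //.
  by rewrite ler_piMl ?(lf_abs_ge0 lf).
have c0 : c != 0 by rewrite -(abs_gt0 ua) cx (lt_le_trans a0).
exists c; split=> //; have -> : x / c - 1 = (x - c) / c by field.
by rewrite (lf_absM lf) (abs_V ua) ltr_pdivrMr ?(abs_gt0 ua) // cx.
Qed.

(** Multiplying by squares of powers of w moves x into one fixed annulus. With [sqrt_near1] this
    says that the square classes of F are finite in number. *)
Lemma square_classes r : 0 < r <= 1 -> exists X : seq F,
  forall x, x != 0 -> exists c y,
    [/\ c \in X, c != 0, y != 0 & abs (x / (c * y ^+ 2) - 1) < r].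
Proof.
move=> r01; have [w uw] := exists_uniformizer lf.
have [w0 w1 _] := uw; have /andP[aw0 aw1] := uniformizer_abs lf uw.
have [X hX] := @annulus_cover (abs w ^+ 2) 1 r (exprn_gt0 _ aw0) r01.
exists X => x x0.
suff [y y0 xy] : exists2 y, y != 0 & abs w ^+ 2 <= abs (x * y ^+ 2) <= 1.
  have [c [cX c0 h]] := hX _ xy; exists c, y^-1; split=> //; first by rewrite invr_eq0.
  by rewrite (_ : x / _ = x * y ^+ 2 / c) //; field; rewrite c0.
(* Starting from |x z^2| > 1 makes the least n with |x (z w^n)^2| <= 1 positive, and its predecessor
   supplies the lower bound |w|^2. *)
have [z z0 zx] := exists_large lf (1 + (abs x)^-1).
have ax : 0 < abs x by rewrite (abs_gt0 ua).
have az : 0 < abs z by rewrite (abs_gt0 ua).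
have big : 1 < abs (x * z ^+ 2).
  rewrite (lf_absM lf) (abs_X ua) expr2 mulrA.
  have h1 : 1 < abs z by rewrite (le_lt_trans _ zx) // lerDl invr_ge0 ltW.
  have h2 : 1 < abs x * abs z.
    by rewrite mulrC -ltr_pdivrMr // mul1r (le_lt_trans _ zx) // lerDr.
  by rewrite (lt_trans h1) // ltr_pMl.
have ex : exists n, abs (x * (z * w ^+ n) ^+ 2) <= 1.
  have [||n /(_ n (leqnn _)) hn] := @expr_lt_eps _ (abs w) (abs (x * z ^+ 2))^-1.
  - by rewrite ltW.
  - by rewrite invr_gt0 (lt_trans _ big).
  exists n; rewrite exprMn mulrA (lf_absM lf) (abs_X ua) (abs_X ua) mulrC.
  rewrite -ler_pdivlMr ?(lt_trans _ big) // mul1r expr2.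
  have wn : 0 <= abs w ^+ n <= 1 by rewrite exprn_ge0 ?exprn_ile1 ?ltW.
  case/andP: wn => wn0 wn1.
  by rewrite (le_trans _ (ltW hn)) // ler_piMl.
case: (ex_minnP ex) => -[|n] hn hmin.
  by move: hn; rewrite expr0 mulr1 leNgt big.
exists (z * w ^+ n.+1); first by rewrite mulf_neq0 // expf_neq0.
rewrite hn andbT.
have h : 1 < abs (x * (z * w ^+ n) ^+ 2).
  by rewrite ltNge; apply/negP => /hmin; rewrite ltnn.
have -> : x * (z * w ^+ n.+1) ^+ 2 = w ^+ 2 * (x * (z * w ^+ n) ^+ 2).
  by rewrite (exprS w n); ring.
by rewrite (lf_absM lf (w ^+ 2)) (abs_X ua) ler_peMr ?exprn_ge0 ?ltW.
Qed.

End LocalFieldCovers.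

Section AdicTopologyTheory.
Variables (R : realType) (K : fieldType) (abs : K -> R).
Hypothesis ua : ultrametric abs.

Lemma adic_nbhsP (x : adic abs) (A : set (adic abs)) :
  nbhs x A <-> exists2 e, 0 < e & forall y : K, abs (y - x) < e -> A y.
Proof.
rewrite nbhsE; split => [[U [oU Ux] UA]|[e e0 eA]].
  have [e e0 eU] := oU x Ux; exists e => // y /eU; exact: UA.
exists [set y : adic abs | abs ((y : K) - x) < e] => //; split; last first.
  by rewrite /= subrr (abs_0 ua).
move=> y /= yx; exists e => // z zy.
exact: (abs_dist_lt ua zy yx).
Qed.

(** An ultrafilter on the ball contains, for each n, one of the finitely many covering balls of
    radius 2^-n. Their centres form a Cauchy sequence, whose limit is the limit of the
    ultrafilter. *)
Lemma compact_adic_ball M : totally_bounded abs -> abs_complete abs ->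
  compact [set x : adic abs | abs x <= M].
Proof.
move=> tb cpl; rewrite compact_ultra => U UU UM.
pose rho : R := 2^-1.
have rho01 : 0 <= rho < 1 by rewrite /rho; lra.
have rho0 : 0 < rho by rewrite /rho; lra.
have hc n : exists c : K, U [set x : adic abs | abs ((x : K) - c) < rho ^+ n].
  have [X hX] := tb M (rho ^+ n) (exprn_gt0 n rho0).
  have : U [set x : adic abs | exists2 c, c \in X & abs ((x : K) - c) < rho ^+ n].
    by apply: filterS UM => x /hX.
  elim: X {hX} => [|c X IH] hU.
    by have [x []] := filter_ex hU.
  have [?|nU] := in_ultra_setVsetC [set x : adic abs | abs ((x : K) - c) < rho ^+ n] UU.
    by exists c.
  apply: IH; apply: filterS2 hU nU => x [d]; rewrite inE => /orP[/eqP->|dX] xd //= nx.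
  by exists d.
have [c hcU] := choice hc.
have cc n : abs (c n.+1 - c n) <= 1 * rho ^+ n.
  have [x [h1 h2]] := filter_ex (filterI (hcU n.+1) (hcU n)).
  rewrite mul1r ltW // (abs_dist_lt ua (y := x)) // (abs_B ua).
  by rewrite (lt_le_trans h1) // exprS ler_piMl ?exprn_ge0 ?ltW //; case/andP: rho01.
have [l hl] := geometric_limit ua cpl rho01 cc.
have Ul : U --> (l : adic abs).
  move=> A /adic_nbhsP[e e0 eA].
  have [n /(_ n (leqnn _)) hn] := expr_lt_eps rho01 e0.
  apply: filterS (hcU n) => x /= xc; apply: eA.
  apply: (abs_dist_lt ua (y := c n)); first exact: lt_trans xc hn.
  by rewrite (abs_B ua) (le_lt_trans (hl n)) // mul1r.
exists l; split=> //=.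
(* If |l| > M, then [abs] is constantly |l| on a neighbourhood of l, which therefore misses the
   ball. *)
rewrite leNgt; apply/negP => Ml.
have : U [set x : adic abs | abs ((x : K) - l) < abs l].
  by apply: Ul; apply/adic_nbhsP; exists (abs l) => //; rewrite (le_lt_trans _ Ml)//;
    have [x /= xM] := filter_ex UM; rewrite (le_trans _ xM) //; case: ua.
move=> /(filterI UM) /filter_ex [x /= [xM /(abs_near ua) e]].
by move: Ml; rewrite -e ltNge xM.
Qed.

(** Schwartz functions described by [abs] alone, with one radius of constancy for all points. The
    next two lemmas relate this to the topological definition. *)
Definition uniformly_schwartz (T : Type) (t0 : T) (f : K -> T) : Prop :=
  exists e M, [/\ 0 < e, forall x y, abs (x - y) < e -> f x = f y &
    forall x, f x <> t0 -> abs x <= M].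

(** Compactness of the support, in its near-covering form, makes the radius (as e tends to 0) and
    the bound (as M tends to infinity) uniform. *)
Lemma schwartz_uniform (phi : K -> R[i]^o) : schwartz abs phi ->
  uniformly_schwartz 0 phi.
Proof.
move=> [lc cpt].
set S := closure _ in cpt; have SS x : phi x <> 0 -> S x.
  by move=> /eqP h; exact: subset_closure.
move/compact_near_coveringP : (cpt) => nc.
have h1 : \forall e \near 0^'+, S `<=` [set x : adic abs |
    forall y : K, abs (y - x) < e -> phi y = phi x].
  apply: nc => x _; have /adic_nbhsP[e e0 he] := lc x.
  exists ([set y : adic abs | abs ((y : K) - x) < e], [set e1 : R | e1 < e]).
    split; first by apply/adic_nbhsP; exists e.
    by apply: nbhs_right_lt.
  move=> [y e1] /= [yx e1e] z zy.
  rewrite (he y yx) he //; apply: (abs_dist_lt ua (y := y)) => //.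
  exact: lt_trans zy e1e.
have h2 : \forall M \near +oo, S `<=` [set x : adic abs | abs x <= M].
  apply: nc => x _.
  exists ([set y : adic abs | abs ((y : K) - x) < 1],
          [set M : R | Num.max (abs x) 1 < M]).
    split; first by apply/adic_nbhsP; exists 1.
    by apply: nbhs_pinfty_gt; rewrite num_real.
  move=> [y e1] /= [yx]; rewrite gt_max => /andP[e1e e2].
  by rewrite -(subrK x y) (abs_add_le ua) // ltW // (lt_trans yx).
have [e [e0 he]] : exists e : R, 0 < e /\ S `<=` [set x : adic abs |
    forall y : K, abs (y - x) < e -> phi y = phi x].
  near (0 : R)^'+ => e; exists e; split; first by near: e; exact: nbhs_right_gt.
  by near: e.
have [M hM] : exists M : R, S `<=` [set x : adic abs | abs x <= M].
  by near (pinfty_nbhs R) => M; exists M; near: M.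
exists e, M; split=> // [x y xy|x /SS /hM //].
have [x0|/eqP/SS Sx] := eqVneq (phi x) 0; last first.
  by apply/esym/(he _ Sx); rewrite (abs_B ua).
have [y0|/eqP/SS Sy] := eqVneq (phi y) 0; first by rewrite x0 y0.
exact: he _ Sy _ xy.
Unshelve. all: by end_near. Qed.

Lemma uniform_schwartz (phi : K -> R[i]^o) :
  totally_bounded abs -> abs_complete abs ->
  uniformly_schwartz 0 phi -> schwartz abs phi.
Proof.
move=> tb cpl [e [M0 [e0 he hM0]]]; split.
  by move=> x; apply/adic_nbhsP; exists e => // y /he.
pose M := Num.max M0 0; have M_ge0 : 0 <= M by rewrite le_max lexx orbT.
have hM x : phi x <> 0 -> abs x <= M by move=> /hM0 h; rewrite le_max h.
have cl : closed [set x : adic abs | abs x <= M].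
  have op : adic_open (~` [set x : adic abs | abs x <= M]).
    move=> x /= /negP; rewrite -ltNge => Mx.
    exists (abs x); first exact: le_lt_trans M_ge0 Mx.
    by move=> y /(abs_near ua) -> /=; apply/negP; rewrite -ltNge.
  by rewrite -[X in closed X]setCK; exact: open_closedC.
have sub : closure [set x : adic abs | phi x != 0] `<=` [set x : adic abs | abs x <= M].
  rewrite [X in _ `<=` X](closure_id _).1 //; apply: closure_subset => x /= /eqP.
  exact: hM.
have cc := @closed_closure _ [set x : adic abs | phi x != 0].
exact: subclosed_compact cc (compact_adic_ball (M := M) tb cpl) sub.
Qed.

End AdicTopologyTheory.

(** * Extension of characters when the quotient has exponent two *)

Definition mult_subgroup (F : fieldType) (L : set F) : Prop :=
  [/\ L 1, forall x y, L x -> L y -> L (x * y), forall x, L x -> L x^-1 &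
      forall x, L x -> x != 0].

Definition multiplicative_on (F C : fieldType) (L : set F) (chi : F -> C) : Prop :=
  forall x y, L x -> L y -> chi (x * y) = chi x * chi y.

(** The elements of X are adjoined one at a time. As x^2 already lies in L, the new group is the
    union of L and x L, and any square root s of chi(x^2) in C may serve as the value at x. *)
Lemma extend_char (F : fieldType) (C : closedFieldType) (N : set F) (chi0 : F -> C)
    (X : seq F) :
  mult_subgroup N -> multiplicative_on N chi0 -> chi0 1 = 1 ->
  (forall x, x != 0 -> N (x ^+ 2)) ->
  exists L chi, [/\ mult_subgroup L, multiplicative_on L chi,
    N `<=` L /\ (forall x, N x -> chi x = chi0 x) &
    forall x, x \in X -> x != 0 -> L x].
Proof.
move=> Ng chi0M chi01 Nsq; elim: X => [|x X [L [chi [Lg chiM [NL chiE] XL]]]].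
  by exists N, chi0; split=> //; split.
have [xL|xL] := pselect (x = 0 \/ L x).
  exists L, chi; split=> // y; rewrite inE => /orP[/eqP ->|]; last exact: XL.
  by case: xL => // ->; rewrite eqxx.
have [x0 {}xL] : x != 0 /\ ~ L x by split; [apply/eqP|]; tauto.
have [L1 LM LV L0] := Lg.
have x2L : L (x ^+ 2) by apply/NL/Nsq.
have LMr y z : L z -> L (y * z) <-> L y.
  move=> Lz; split=> [h|]; last by move=> Ly; exact: LM.
  by have := LM _ _ h (LV _ Lz); rewrite mulfK // L0.
have LMl y z : L y -> L (y * z) <-> L z by rewrite mulrC; exact: LMr.
have [s s2] : exists s : C, s ^+ 2 = chi (x ^+ 2).
  have [s sE] := @solve_monicpoly C 2 (fun i => if i == 0%N then chi (x ^+ 2) else 0) isT.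
  by exists s; rewrite sE !big_ord_recl big_ord0 /= expr0 mulr1 mul0r !addr0.
pose L' : set F := [set y | L y \/ L (y / x)].
pose chi' y := if `[< L y >] then chi y else s * chi (y / x).
have chi'L y : L y -> chi' y = chi y by move=> Ly; rewrite /chi' asboolT.
have chi'N y : ~ L y -> chi' y = s * chi (y / x) by move=> Ly; rewrite /chi' asboolF.
have split2 y z : (y / x) * (z / x) = y * z * (x ^+ 2)^-1.
  by field; rewrite x0.
have LL y z : L (y / x) -> L (z / x) -> L (y * z).
  by move=> ly lz; have := LM _ _ ly lz; rewrite split2 LMr //; exact: LV.
exists L', chi'; split.
- split; first by left.
  + move=> y z [ly|ly] [lz|lz].
    * by left; exact: LM.
    * by right; rewrite -mulrA; exact: LM.
    * by right; rewrite mulrAC; exact: LM.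
    * by left; exact: LL.
  + move=> y [ly|ly]; first by left; exact: LV.
    right; have y0 : y != 0.
      by have := L0 _ ly; rewrite mulf_eq0 negb_or => /andP[].
    have -> : y^-1 / x = (y / x)^-1 * (x ^+ 2)^-1 by field; rewrite x0 y0.
    by apply: LM; apply: LV.
  + move=> y [/L0//|/L0]; by rewrite mulf_eq0 negb_or => /andP[].
- move=> y z ly lz.
  have [Ly|nLy] := pselect (L y); have [Lz|nLz] := pselect (L z).
  + by rewrite !chi'L //; [exact: chiM|exact: LM].
  + rewrite (chi'L y) // (chi'N z) // chi'N ?LMl // -(mulrA y) (chiM y (z / x)) //.
      by rewrite mulrCA.
    by case: lz.
  + rewrite (chi'L z) // (chi'N y) // chi'N ?LMr // (mulrAC y) (chiM (y / x)) //.
      by rewrite mulrA.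
    by case: ly.
  + have {}ly : L (y / x) by case: ly.
    have {}lz : L (z / x) by case: lz.
    rewrite (chi'L (y * z)); last exact: LL.
    rewrite !chi'N // mulrACA -expr2 s2 -chiM // -chiM //; last exact: LM.
    by congr chi; field.
- split=> [y Ny|y Ny]; first by left; exact: NL.
  by rewrite chi'L ?chiE //; exact: NL.
- move=> y; rewrite inE => /orP[/eqP-> _|yX y0]; last by left; exact: XL.
  by right; rewrite divff.
Qed.

(** * Total boundedness and completeness of E *)

Section AdmissiblePairTheory.
Variables (R : realType) (F : fieldType) (abs : F -> R).
Variables (E : splittingFieldType F) (Delta : F) (delta : E) (sigma : gal_of {:E}).
Variable Theta : E -> R[i].
Hypotheses (lf : local_field abs) (ch0 : [pchar F] =i pred0).
Hypotheses (sG : sigma \in 'Gal({:E} / 1)%g) (sigma1 : sigma != 1%g).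
Hypothesis qe : quadratic_ext Delta delta.

Let ua := local_field_ultrametric lf.
Let uaE := absE_ultrametric qe sG sigma1 lf.
Let two0 : (2 : F) != 0. Proof. by rewrite ((pcharf0P _).1 ch0). Qed.
Let absE_ge0 (z : E) : 0 <= absE abs z. Proof. by case: uaE. Qed.

Let le_1sqr (t m : R) : t ^+ 2 <= m -> t <= 1 + m.
Proof. by move=> tm; nra. Qed.

Lemma absE_coords_small (e : R) : 0 < e -> exists2 e1, 0 < e1 &
  forall x y : F, abs x < e1 -> abs y < e1 -> absE abs (x%:A + y *: delta) < e.
Proof.
move=> e0; pose k := 1 + absE abs delta.
have k1 : 1 <= k by rewrite lerDl.
pose e1 := Num.min 1 (e / k).
have e10 : 0 < e1 by rewrite lt_min ltr01 divr_gt0 // (lt_le_trans _ k1).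
have [e11 e1k] : e1 <= 1 /\ e1 * k <= e.
  split; first by rewrite ge_min lexx.
  by rewrite -ler_pdivlMr ?(lt_le_trans _ k1) // ge_min lexx orbT.
have sq (t : F) : abs t < e1 -> abs t ^+ 2 < e1.
  by move=> te; have := lf_abs_ge0 lf t; nra.
exists e1 => // x y /sq xe /sq ye; apply: (abs_add_lt uaE).
  rewrite (absE_alg qe sG sigma1 lf); apply: lt_le_trans xe _.
  by rewrite (le_trans _ e1k) // ler_peMr // ltW.
rewrite (absE_scale qe sG sigma1 lf).
apply: le_lt_trans (_ : e1 * absE abs delta < _); first by rewrite ler_wpM2r // ltW.
by apply: lt_le_trans e1k; rewrite ltr_pM2l // /k ltrDr.
Qed.

Lemma absE_totally_bounded : totally_bounded (@absE F E R abs).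
Proof.
move=> M e e0; have [e1 e10 he1] := absE_coords_small e0.
have tb := local_field_totally_bounded lf.
(* The coordinate estimates bound squares; t <= 1 + t^2 turns them into bounds on t without square
   roots. *)
have [X hX] := tb (1 + M / abs 2 ^+ 2) e1 e10.
have [Y hY] := tb (1 + M / (abs 2 ^+ 2 * absE abs delta)) e1 e10.
exists [seq x%:A + y *: delta | x <- X, y <- Y] => z zM.
have [x [y ez]] := quadratic_coords qe z.
have a2 : 0 <= abs 2 ^+ 2 by rewrite exprn_ge0 ?(lf_abs_ge0 lf).
have [|c cX hc] := hX x.
  apply/le_1sqr/(le_trans (abs_coord1 ch0 qe sG sigma1 lf x y)).
  by rewrite -ez ler_wpM2r ?invr_ge0.
have [|d dY hd] := hY y.
  apply/le_1sqr/(le_trans (abs_coord2 ch0 qe sG sigma1 lf x y)).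
  by rewrite -ez ler_wpM2r ?invr_ge0 // mulr_ge0.
exists (c%:A + d *: delta); first by apply/allpairsP; exists (c, d).
have -> : z - (c%:A + d *: delta) = (x - c)%:A + (y - d) *: delta.
  by rewrite ez opprD addrACA !scalerBl.
exact: he1.
Qed.

Lemma absE_complete : abs_complete (@absE F E R abs).
Proof.
move=> u hu.
have /choice[xy hxy] n : exists p : F * F, u n = p.1%:A + p.2 *: delta.
  by have [x [y ->]] := quadratic_coords qe (u n); exists (x, y).
have diff m n : u m - u n =
    ((xy m).1 - (xy n).1)%:A + ((xy m).2 - (xy n).2) *: delta.
  by rewrite !hxy opprD addrACA !scalerBl.
have a0 := lf_abs_ge0 lf.
have d0 : 0 < absE abs delta.
  rewrite (abs_gt0 uaE); apply/eqP => d0; case: qe => D0 _ + _.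
  rewrite d0 expr0n /= => /esym/eqP.
  by rewrite scaler_eq0 oner_eq0 orbF; apply/negP.
have a2 : 0 < abs 2 ^+ 2 by rewrite exprn_gt0 // (abs_gt0 ua).
have sqlt (s t : R) : 0 <= s -> 0 < t -> s ^+ 2 < t ^+ 2 -> s < t.
  by move=> s0 t0; rewrite ltr_pXn2r // nnegrE // ltW.
have [e e0|x hx] := lf_complete lf (u := fun n => (xy n).1).
  have [N hN] := hu (e ^+ 2 * abs 2 ^+ 2) (mulr_gt0 (exprn_gt0 _ e0) a2).
  exists N => m n Nm Nn; apply: sqlt => //.
  apply: le_lt_trans (abs_coord1 ch0 qe sG sigma1 lf _ ((xy m).2 - (xy n).2)) _.
  by rewrite -diff ltr_pdivrMr // hN.
have [e e0|y hy] := lf_complete lf (u := fun n => (xy n).2).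
  have a2d := mulr_gt0 a2 d0.
  have [N hN] := hu (e ^+ 2 * (abs 2 ^+ 2 * absE abs delta))
    (mulr_gt0 (exprn_gt0 _ e0) a2d).
  exists N => m n Nm Nn; apply: sqlt => //.
  apply: le_lt_trans (abs_coord2 ch0 qe sG sigma1 lf ((xy m).1 - (xy n).1) _) _.
  by rewrite -diff ltr_pdivrMr // hN.
exists (x%:A + y *: delta) => e e0.
have [e1 e10 he1] := absE_coords_small e0.
have [N1 h1] := hx e1 e10; have [N2 h2] := hy e1 e10.
exists (maxn N1 N2) => n; rewrite geq_max => /andP[n1 n2].
have -> : u n - (x%:A + y *: delta) = ((xy n).1 - x)%:A + ((xy n).2 - y) *: delta.
  by rewrite hxy opprD addrACA !scalerBl.
by apply: he1; [exact: h1|exact: h2].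
Qed.

End AdmissiblePairTheory.

(** * The space of theta-equivariant Schwartz functions *)

Section MultChar.
Variables (R : realType) (K : fieldType) (abs : K -> R) (chi : K -> R[i]).
Hypothesis mc : mult_char abs chi.

Lemma mult_char1 : chi 1 = 1. Proof. by case: mc. Qed.

Lemma mult_charM x y : x != 0 -> y != 0 -> chi (x * y) = chi x * chi y.
Proof. by case: mc => _ + _; apply. Qed.

Lemma mult_char_neq0 x : x != 0 -> chi x != 0.
Proof.
move=> x0; apply/eqP => c0; have xV0 : x^-1 != 0 by rewrite invr_eq0.
by have /eqP := mult_charM x0 xV0; rewrite divff // mult_char1 c0 mul0r oner_eq0.
Qed.

End MultChar.

Section SchwartzTheta.
Variables (R : realType) (F : fieldType) (abs : F -> R).
Variables (E : splittingFieldType F) (Delta : F) (delta : E) (sigma : gal_of {:E}).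
Variable Theta : E -> R[i].
Hypotheses (lf : local_field abs) (ch0 : [pchar F] =i pred0).
Hypotheses (sG : sigma \in 'Gal({:E} / 1)%g) (sigma1 : sigma != 1%g).
Hypothesis ap : admissible_pair abs Delta delta Theta.

Let qe : quadratic_ext Delta delta. Proof. by case: ap. Qed.
Let mcT : mult_char (absE abs) Theta. Proof. by case: ap. Qed.
Let ua := local_field_ultrametric lf.
Let uaE := absE_ultrametric qe sG sigma1 lf.
Let nE0 := nrm_eq0 qe sG sigma1.
Let nM := nrmM qe sG sigma1.
Let n1 := nrm1 qe sG sigma1.
Let absEM (y z : E) : absE abs (y * z) = absE abs y * absE abs z.
Proof. by case: uaE. Qed.
Local Notation V := (schwartz_theta abs Theta).

Lemma absE_alg_near1 (e : R) : 0 < e -> exists2 d, 0 < d &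
  forall y : F, abs (y - 1) < d -> absE abs (y%:A - 1 : E) < e.
Proof.
move=> e0; exists (Num.min 1 e); first by rewrite lt_min ltr01.
move=> y; rewrite lt_min => /andP[y1 ye].
have -> : y%:A - 1 = (y - 1)%:A :> E by rewrite scalerBl scale1r.
rewrite (absE_alg qe sG sigma1 lf).
by have := lf_abs_ge0 lf (y - 1); nra.
Qed.

Lemma Theta_alg_near1 : exists2 d, 0 < d &
  forall y : F, abs (y - 1) < d -> Theta y%:A = 1.
Proof.
case: mcT => _ _ [e e0 he]; have [d d0 hd] := absE_alg_near1 e0.
exists (Num.min 1 d); first by rewrite lt_min ltr01.
move=> y; rewrite lt_min => /andP[y1 yd]; apply: he; last exact: hd.
by rewrite scaler_eq0 oner_eq0 orbF (near1_neq0 ua).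
Qed.

Lemma mult_subgroup_norm : mult_subgroup (norm_group E).
Proof.
split.
- by exists 1; rewrite /= ?oner_eq0.
- by move=> _ _ [z z0 <-] [t t0 <-]; exists (z * t); rewrite /= ?mulf_neq0.
- move=> _ [z z0 <-]; exists z^-1; first by rewrite /= invr_eq0.
  exact: nrmV qe sG sigma1 z.
- by move=> _ [z z0 <-]; rewrite nE0.
Qed.

Lemma norm_group_sqr (x : F) : x != 0 -> norm_group E (x ^+ 2).
Proof.
move=> x0; exists x%:A; first by rewrite /= scaler_eq0 oner_eq0 orbF.
by rewrite (nrm_alg qe sG sigma1).
Qed.

(* Otherwise Theta z depends only on N z, which defines a character of the norm
   group; it extends to the units of F, as the quotient is finite of exponent 2. *)
Lemma Theta_nontrivial_norm1 : exists2 mu : E, nrm mu = 1 & Theta mu != 1.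
Proof.
apply: contrapT => nex; case: ap => _ _ _ + _; apply.
have triv (mu : E) : nrm mu = 1 -> Theta mu = 1.
  by move=> mu1; apply: contrapT => /eqP h; apply: nex; exists mu.
have well (z t : E) : z != 0 -> t != 0 -> nrm z = nrm t -> Theta z = Theta t.
  move=> z0 t0 zt; rewrite -(divfK t0 z) (mult_charM mcT) ?mulf_neq0 ?invr_eq0 //.
  by rewrite triv ?mul1r // nM (nrmV qe sG sigma1) zt divff // nE0.
pose chi0 (x : F) := Theta (xget 1 [set z : E | z != 0 /\ nrm z = x]).
have chi0E (z : E) : z != 0 -> chi0 (nrm z) = Theta z.
  rewrite /chi0 => z0; case: xgetP => [y _ [y0 yz]|/(_ z)]; first exact: well.
  by case.
have chi0M : multiplicative_on (norm_group E) chi0.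
  move=> _ _ [z /= z0 <-] [t /= t0 <-].
  by rewrite -nM !chi0E ?mulf_neq0 // (mult_charM mcT).
have chi01 : chi0 1 = 1 by rewrite -n1 chi0E ?oner_eq0 // (mult_char1 mcT).
have [d d0 hd] := sqrt_near1 lf ch0 ltr01.
pose r : R := Num.min d 1.
have r01 : 0 < r <= 1 by rewrite lt_min d0 ltr01 ge_min lexx orbT.
have [X hX] := square_classes lf r01.
have [L [chi [[L1 LM LV L0] chiM [NL chiE] XL]]] :=
  extend_char X mult_subgroup_norm chi0M chi01 norm_group_sqr.
(* x is a representative c in X times a square times an element close to 1, and the latter is itself
   a square; all squares are norms. *)
have Lall x : x != 0 -> L x.
  move=> x0; have [c [y [cX c0 y0]]] := hX x x0.
  rewrite lt_min => /andP[/hd [u u2 _] xr].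
  have -> : x = c * (y ^+ 2 * u ^+ 2) by rewrite u2; field; rewrite y0 c0.
  apply: (LM); first exact: XL.
  apply: LM; apply/NL/norm_group_sqr => //.
  by rewrite -sqrf_eq0 u2 (near1_neq0 ua).
have chi_nrm (z : E) : z != 0 -> Theta z = chi (nrm z).
  by move=> z0; rewrite chiE ?chi0E //; exists z.
exists chi => //; split.
- by rewrite -n1 -chi_nrm ?oner_eq0 // (mult_char1 mcT).
- by move=> x y x0 y0; apply: chiM; exact: Lall.
(* Smoothness of chi: x close to 1 equals y^2 = N(y) with y close to 1, so chi(x) = Theta(y) = 1. *)
have [d1 d10 hd1] := Theta_alg_near1.
have [d2 d20 hd2] := sqrt_near1 lf ch0 d10.
exists d2 => // x x0 /hd2[y yx /hd1 ty].
have y0 : y != 0 by rewrite -sqrf_eq0 yx.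
by rewrite -yx -(nrm_alg qe sG sigma1) -chi_nrm // scaler_eq0 oner_eq0 orbF.
Qed.

Lemma schwartz_theta0 phi : V phi -> phi 0 = 0.
Proof.
move=> [_ hphi]; have [mu mu1 Tmu] := Theta_nontrivial_norm1.
have := hphi mu 0 mu1; rewrite mul0r => /eqP.
by rewrite -subr_eq0 -{1}[phi 0]mul1r -mulrBl mulf_eq0 subr_eq0 eq_sym (negbTE Tmu) => /eqP.
Qed.

Lemma schwartz_theta_uniform phi : V phi -> uniformly_schwartz (absE abs) 0 phi.
Proof. by move=> [h _]; have := schwartz_uniform uaE h. Qed.

(** The witness is Theta on the units of E, extended by 0. Norm one elements are units, which gives
    equivariance. *)
Lemma schwartz_theta_neq0 : exists2 phi, V phi & phi <> 0.
Proof.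
pose phi : E -> R[i]^o := fun z => if absE abs z == 1 then Theta z else 0.
have absE1 : absE abs (1 : E) = 1 by exact: abs_1 uaE.
exists phi; last first.
  move=> /(congr1 (fun f => f 1)); rewrite /phi absE1 eqxx (mult_char1 mcT) => /eqP.
  by rewrite oner_eq0.
split; last first.
  move=> m a m1; rewrite /phi absEM {2}/absE m1 (abs_1 ua) mulr1.
  case: eqP => [a1|_]; last by rewrite mulr0.
  rewrite mulrC (mult_charM mcT) // -nE0; first by rewrite m1 oner_eq0.
  by rewrite -(abs_gt0 ua) -/(absE abs a) a1.
apply: (uniform_schwartz uaE).
- exact: absE_totally_bounded ch0 sG sigma1 qe.
- exact: absE_complete ch0 sG sigma1 qe.
case: mcT => _ _ [e e0 he].
exists (Num.min 1 e), 1; split; first by rewrite lt_min ltr01.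
  have main x y : absE abs (x - y) < Num.min 1 e -> absE abs y = 1 -> phi x = phi y.
    rewrite lt_min => /andP[xy1 xye] y1.
    have x1 : absE abs x = 1 by rewrite (abs_near uaE (y := y)) y1.
    have y0 : y != 0 by rewrite -(abs_gt0 uaE) y1.
    have x0 : x != 0 by rewrite -(abs_gt0 uaE) x1.
    rewrite /phi x1 y1 eqxx -(divfK y0 x) (mult_charM mcT) ?mulf_neq0 ?invr_eq0 //.
    rewrite he ?mul1r // ?mulf_neq0 ?invr_eq0 //.
    have -> : x / y - 1 = (x - y) / y by field.
    by rewrite absEM (abs_V uaE) y1 invr1 mulr1.
  move=> x y xy; have [y1|y1] := eqVneq (absE abs y) 1; first exact: main.
  have [x1|x1] := eqVneq (absE abs x) 1; first by apply/esym/main => //; rewrite (abs_B uaE).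
  by rewrite /phi (negbTE x1) (negbTE y1).
by move=> x; rewrite /phi; case: eqP => // ->.
Qed.

End SchwartzTheta.

(** * Additive characters and functions on the multiplicative group *)

Section AdditiveCharacters.
Variables (R : realType) (F : fieldType) (abs : F -> R).
Hypothesis lf : local_field abs.
Let ua := local_field_ultrametric lf.
Let absM := lf_absM lf.
Let abs_ge0 := lf_abs_ge0 lf.

Section OneCharacter.
Variable psi : F -> R[i].
Hypothesis ac : add_char abs psi.

Lemma add_char0 : psi 0 = 1. Proof. by case: ac. Qed.

Lemma add_charD x y : psi (x + y) = psi x * psi y. Proof. by case: ac. Qed.

Lemma add_charNM x : psi (- x) * psi x = 1.
Proof. by rewrite -add_charD addNr add_char0. Qed.

Lemma add_char_neq0 x : psi x != 0.
Proof.
by apply/eqP => h; have /eqP := add_charNM x; rewrite h mulr0 eq_sym oner_eq0.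
Qed.
End OneCharacter.

(** The value group is discrete, so there is a largest ball |y| <= |x1| |w|^n on which psi is
    trivial. The element y0 lies one step outside it, and r |-> psi(r y0) is then a nontrivial
    character of the residue field. *)
Lemma add_char_conductor psi : nontrivial_add_char abs psi ->
  exists y0, [/\ y0 != 0, psi y0 != 1 & forall y, abs y < abs y0 -> psi y = 1].
Proof.
move=> [ac [x1 px1]]; have [w uw] := exists_uniformizer lf.
have /andP[w0 w1] := uniformizer_abs lf uw.
have [_ _ [e e0 he]] := ac.
pose P n := `[< forall y, abs y <= abs x1 * abs w ^+ n -> psi y = 1 >].
have x10 : x1 != 0 by apply: contraNneq px1 => ->; rewrite (add_char0 ac).
have ax1 : 0 < abs x1 by rewrite (abs_gt0 ua).
have exP : exists n, P n.
  have [||n /(_ n (leqnn _)) hn] := @expr_lt_eps _ (abs w) (e / abs x1).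
  - by rewrite ltW.
  - by rewrite divr_gt0.
  exists n; apply/asboolP => y hy; apply: he; apply: le_lt_trans hy _.
  by rewrite mulrC -ltr_pdivlMr.
case: (ex_minnP exP) => -[|n] /asboolP hn hmin.
  by move: px1; rewrite hn ?eqxx // expr0 mulr1.
have /asboolP : ~~ P n by apply/negP => /hmin; rewrite ltnn.
move=> /existsNP[y0 /not_implyP[hy0 /eqP py0]].
exists y0; split=> //; first by apply: contraNneq py0 => ->; rewrite (add_char0 ac).
move=> y /(uniformizer_lt lf uw) yy0; apply: hn; apply: le_trans yy0 _.
by rewrite exprSr mulrA ler_wpM2r // ltW.
Qed.

(* Translation by u permutes the residues, which multiplies the sum by chi u. *)
Lemma residue_sum0 (C : idomainType) (chi : F -> C) (s : seq F) (u : F) :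
  residue_system abs s ->
  (forall x y, abs x <= 1 -> abs y <= 1 -> chi (x + y) = chi x * chi y) ->
  (forall x, abs x < 1 -> chi x = 1) ->
  abs u <= 1 -> chi u != 1 -> \sum_(r <- s) chi r = 0.
Proof.
move=> [us sO srep] chiD chi1 uO chiu.
have /choice[p hp] y : exists r, abs y <= 1 -> r \in s /\ abs (y - r) < 1.
  have [yO|nyO] := pselect (abs y <= 1); last by exists 0.
  by have [r [hr _]] := srep y yO; exists r.
have O x : x \in s -> abs (x + u) <= 1 by move=> /sO xO; exact: abs_add_le.
have ps : perm_eq [seq p (r + u) | r <- s] s.
  have un : uniq [seq p (r + u) | r <- s].
    rewrite map_inj_in_uniq // => x y xs ys e.
    have [_ hx] := hp _ (O _ xs); have [_ hy] := hp _ (O _ ys).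
    have xy : abs (x - y) < 1.
      have -> : x - y = (x + u - p (x + u)) - (y + u - p (x + u)) by ring.
      by apply: (abs_sub_lt ua) => //; rewrite e.
    have [r [_ hr]] := srep x (sO _ xs).
    rewrite -(hr y) // -(hr x) //; split=> //.
    by rewrite subrr (abs_0 ua).
  apply: uniq_perm => //; apply: (uniq_min_size un _ _).2; last by rewrite size_map.
  by move=> _ /mapP[x xs ->]; have [] := hp _ (O _ xs).
have : (chi u - 1) * \sum_(r <- s) chi r = 0.
  have e : \sum_(r <- s) chi r = \sum_(r <- s) chi (p (r + u)).
    by rewrite -(perm_big _ ps) big_map.
  rewrite mulrBl mul1r {2}e mulr_sumr -sumrB.
  rewrite big_seq big1 // => r rs; have [pr hr] := hp _ (O _ rs).
  have {}hr : chi (r + u) = chi (p (r + u)).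
    rewrite -[in LHS](subrK (p (r + u)) (r + u)) chiD; last exact: sO.
      by rewrite (chi1 _ hr) mul1r.
    exact: ltW.
  by rewrite -hr chiD ?(sO r) // mulrC subrr.
by move/eqP; rewrite mulf_eq0 subr_eq0 (negbTE chiu) => /eqP.
Qed.

(** Orthogonality on the residue field: for |y| = |y0| the character r |-> psi(r y) is nontrivial,
    as r = y0 / y shows. The sum thus detects |y| < |y0|. *)
Lemma residue_sum_add_char psi y0 s y :
  add_char abs psi -> psi y0 != 1 -> (forall y, abs y < abs y0 -> psi y = 1) ->
  residue_system abs s -> abs y <= abs y0 ->
  \sum_(r <- s) psi (r * y) = if abs y < abs y0 then (size s)%:R else 0.
Proof.
move=> ac py0 hy0 rs yy0; have [us sO _] := rs.
case: ltP => h.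
  rewrite big_seq (eq_bigr (fun=> 1)) => [|r /sO rO].
    by rewrite -big_seq big_const_seq count_predT iter_addr_0.
  by rewrite hy0 // absM (le_lt_trans _ h) // ler_piMl.
have {h yy0} ey : abs y = abs y0 by apply/eqP; rewrite eq_le yy0 h.
have y00 : y0 != 0 by apply: contraNneq py0 => ->; rewrite (add_char0 ac).
have yN0 : y != 0 by rewrite -(abs_gt0 ua) ey (abs_gt0 ua).
apply: (residue_sum0 rs (chi := fun r => psi (r * y)) (u := y0 / y)).
- by move=> a b _ _; rewrite mulrDl (add_charD ac).
- by move=> a a1; rewrite hy0 // absM ey gtr_pMl // (abs_gt0 ua).
- by rewrite absM (abs_V ua) ey divff // gt_eqF // (abs_gt0 ua).
- by rewrite divfK.
Qed.

Lemma residue_system_size s : residue_system abs s -> (size s)%:R != 0 :> R[i].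
Proof.
move=> [_ _ /(_ 0)]; rewrite (abs_0 ua) ler01 => /(_ isT)[r [[rs _] _]].
by rewrite pnatr_eq0; case: s rs.
Qed.

Section Mirabolic.
Variables (psi : F -> R[i]) (K : set (F -> R[i])).
Hypothesis nc : nontrivial_add_char abs psi.

(* The locally constant functions with compact support in F \ {0}. *)
Definition kirillov_function (u : F -> R[i]) : Prop :=
  exists e a M, [/\ 0 < e, 0 < a, forall x y, abs (y - 1) < e -> u (x * y) = u x &
    forall x, u x <> 0 -> a <= abs x <= M].

Hypothesis Klin : forall (a : R[i]) u v, K u -> K v -> K (fun x => a * u x + v x).
Hypothesis Kpsi : forall b u, K u -> K (fun x => psi (b * x) * u x).
Hypothesis Ktrans : forall y u, y != 0 -> K u -> K (fun x => u (x * y)).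
Hypothesis Kkir : forall u, K u -> kirillov_function u.
Hypothesis Kneq0 : exists u x, K u /\ u x <> 0.

Let K0 : K (fun=> 0).
Proof.
have [u [_ [Ku _]]] := Kneq0.
have -> : (fun=> 0) = (fun x => -1 * u x + u x); last exact: Klin.
by apply/funext => x; rewrite mulN1r addNr.
Qed.

Let Kscale a u : K u -> K (fun x => a * u x).
Proof.
move=> Ku; have -> : (fun x => a * u x) = (fun x => a * u x + 0); last exact: Klin.
by apply/funext => x; rewrite addr0.
Qed.

Let Ksum (s : seq F) (c : F -> R[i]) (u : F -> F -> R[i]) :
  (forall r, K (u r)) -> K (fun x => \sum_(r <- s) c r * u r x).
Proof.
move=> Ku; elim: s => [|r s IH].
  have -> : (fun x => \sum_(r <- [::]) c r * u r x) = (fun=> 0) => //.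
  by apply/funext => x; rewrite big_nil.
have -> : (fun x => \sum_(i <- r :: s) c i * u i x) =
  (fun x => c r * u r x + \sum_(i <- s) c i * u i x); last exact: Klin.
by apply/funext => x; rewrite big_cons.
Qed.

(** Averaging the multiplications by psi(r t (x - x0)) over the residues r, all of which preserve K,
    restricts u to the open ball inside a closed ball that contains its support. *)
Let cut y0 x0 t u : psi y0 != 1 -> (forall y, abs y < abs y0 -> psi y = 1) -> K u ->
  (forall x, u x <> 0 -> abs (t * (x - x0)) <= abs y0) ->
  K (fun x => if abs (t * (x - x0)) < abs y0 then u x else 0).
Proof.
move=> py0 hy0 Ku hu; have [ac _] := nc.
have [w [s [_ rs _]]] := lf_normalized lf.
have q0 := residue_system_size rs.
have -> : (fun x => if abs (t * (x - x0)) < abs y0 then u x else 0) =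
  (fun x => (size s)%:R^-1 *
     \sum_(r <- s) psi (- (r * t * x0)) * (psi (r * t * x) * u x)).
  apply/funext => x.
  under eq_bigr do rewrite mulrA -(add_charD ac).
  have [->|/eqP/hu hx] := eqVneq (u x) 0.
    by rewrite if_same big1 ?mulr0 // => r _; rewrite mulr0.
  rewrite -mulr_suml; under eq_bigr => r _ do
    rewrite addrC -mulrBr -mulrA.
  rewrite (residue_sum_add_char ac py0 hy0 rs hx).
  by case: ifP => _; rewrite ?mul0r ?mulr0 // mulKf.
apply: Kscale.
exact: (Ksum s (fun r => psi (- (r * t * x0)))
  (u := fun r x => psi (r * t * x) * u x) (fun r => Kpsi (r * t) Ku)).
Qed.

Lemma mirabolic_full v : kirillov_function v -> K v.
Proof.
have [ac _] := nc; have [y0 [y00 py0 hy0]] := add_char_conductor nc.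
have [u [x1 [Ku ux1]]] : exists u x, K u /\ u x <> 0 := Kneq0.
have x10 : x1 != 0.
  apply/eqP => x10; have [e [a [M [_ a0 _ /(_ x1 ux1)]]]] := Kkir Ku.
  by rewrite x10 (abs_0 ua) leNgt a0.
have {Ku} := Ktrans x10 Ku; set u1 := (fun x => u (x * x1)) => Ku1.
have {ux1} u11 : u1 1 <> 0 by rewrite /u1 mul1r.
have [e [a [M [e0 a0 ue uM]]]] := Kkir Ku1.
move=> [e' [a' [M' [e'0 a'0 ve vM]]]].
have [w uw] := exists_uniformizer lf; have [w0 _ _] := uw.
have /andP[aw0 aw1] := uniformizer_abs lf uw.
have Mg0 : 0 < Num.max M 1 by rewrite lt_max ltr01 orbT.
have ay0 : 0 < abs y0 by rewrite (abs_gt0 ua).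
(* With t this small the first cut applies to the whole support of u1; each further cut shrinks the
   ball around 1 by the factor |w|. *)
have [t t0 tM] := exists_small lf (divr_gt0 ay0 Mg0).
have at0 : 0 < abs t by rewrite (abs_gt0 ua).
have iter n : K (fun x => if abs (t / w ^+ n * (x - 1)) < abs y0 then u1 x else 0).
  elim: n => [|n IH].
    rewrite expr0 divr1; apply: cut => // x /uM /andP[_ xM].
    rewrite absM; apply: (@le_trans _ _ (abs t * Num.max M 1)).
      by rewrite ler_wpM2l // (abs_sub_le ua) // ?(abs_1 ua) le_max ?xM ?lexx ?orbT.
    by rewrite -ler_pdivlMr // ltW.
  have wE x : t / w ^+ n * (x - 1) = (t / w ^+ n.+1 * (x - 1)) * w.
    by rewrite exprS; field; rewrite w0 expf_neq0.
  have H x : abs (t / w ^+ n * (x - 1)) < abs y0 ->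
      abs (t / w ^+ n.+1 * (x - 1)) <= abs y0.
    by move=> /(uniformizer_lt lf uw); rewrite wE absM ler_pM2r.
  have H' x : abs (t / w ^+ n.+1 * (x - 1)) < abs y0 ->
      abs (t / w ^+ n * (x - 1)) < abs y0.
    by move=> h; rewrite wE absM (le_lt_trans _ h) // ler_piMr // ltW.
  have := @cut y0 1 (t / w ^+ n.+1) _ py0 hy0 IH.
  have -> : (fun x => if abs (t / w ^+ n.+1 * (x - 1)) < abs y0 then
      if abs (t / w ^+ n * (x - 1)) < abs y0 then u1 x else 0 else 0) =
    (fun x => if abs (t / w ^+ n.+1 * (x - 1)) < abs y0 then u1 x else 0).
    by apply/funext => x; case: ifP => // /H' ->.
  by apply=> x; case: ifP => // /H.
pose m := Num.min (Num.min e e') 1.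
have m0 : 0 < m by rewrite !lt_min e0 e'0 ltr01.
have [||n /(_ n (leqnn _)) hn] := @expr_lt_eps _ (abs w) (m * abs t / abs y0).
- by rewrite ltW.
- by rewrite divr_gt0 ?mulr_gt0.
(* The radius of the ball left after the cut of index n. It is below e, so u1 is constant there,
   below e', so v is constant on its cosets, and below 1. *)
pose rho := abs y0 * abs w ^+ n / abs t.
have rhom : rho < m by rewrite /rho ltr_pdivrMr // mulrC -ltr_pdivlMr.
have rho0 : 0 < rho by rewrite divr_gt0 ?mulr_gt0 ?exprn_gt0.
have [re re' r1] : [/\ rho < e, rho < e' & rho < 1].
  by move: rhom; rewrite !lt_min => /andP[/andP[-> ->] ->].
have K1 : K (fun x => if abs (x - 1) < rho then 1 else 0).
  have -> : (fun x => if abs (x - 1) < rho then 1 else 0) =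
    (fun x => (u1 1)^-1 * if abs (t / w ^+ n * (x - 1)) < abs y0 then u1 x else 0);
    last exact: Kscale (iter n).
  apply/funext => x.
  have -> : (abs (t / w ^+ n * (x - 1)) < abs y0) = (abs (x - 1) < rho).
    rewrite absM absM (abs_V ua) (abs_X ua) /rho ltr_pdivlMr // mulrAC.
    by rewrite ltr_pdivrMr ?exprn_gt0 // mulrC.
  case: ifP => h; last by rewrite mulr0.
  have := ue 1 x (lt_trans h re); rewrite mul1r => ->.
  by rewrite mulVf //; apply/eqP.
(* The coset of each centre c is peeled off in turn: its indicator is the translate by c^-1 of the
   indicator of the ball around 1. *)
have small (X : seq F) : forall v : F -> R[i], (forall x y, abs (y - 1) < rho -> v (x * y) = v x) ->
    (forall x, v x <> 0 -> exists c, [/\ c \in X, c != 0 & abs (x / c - 1) < rho]) ->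
    K v.
  elim: X => [|c X IH] {vM ve} v vr vX.
    have -> : v = (fun=> 0) => //; apply/funext => x.
    by apply: contrapT => /vX [c [cX]].
  have [c0|c0] := eqVneq c 0.
    apply: IH => // x /vX[d [+ d0 hd]]; rewrite inE c0 (negbTE d0) /= => dX.
    by exists d.
  pose v' x := if abs (x / c - 1) < rho then 0 else v x.
  have -> : v = (fun x => v c * (if abs (x * c^-1 - 1) < rho then 1 else 0) + v' x).
    apply/funext => x; rewrite /v'; case: ifP => h; last by rewrite mulr0 add0r.
    by rewrite addr0 mulr1 -(vr c (x / c) h) mulrC divfK.
  have cV : c^-1 != 0 by rewrite invr_eq0.
  have Kv' : K v'.
    apply: IH => [x y hy|x].
      have -> : v' (x * y) = v' x => //.
      rewrite /v' vr //; have y00' := near1_neq0 ua (lt_trans hy r1).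
      have -> // : (abs (x * y / c - 1) < rho) = (abs (x / c - 1) < rho).
      apply/idP/idP => h; last by rewrite mulrAC (near1_mul ua) // ltW.
      have -> : x / c = (x * y / c) * y^-1 by field; rewrite y00' c0.
      by rewrite (near1_mul ua) ?(near1_inv ua) // ltW.
    rewrite /v'; case: ifP => // hc /vX[d [+ d0 hd]].
    by rewrite inE => /orP[/eqP e1|dX]; [rewrite e1 hc in hd|exists d].
  exact: Klin (v c) _ _ (Ktrans cV K1) Kv'.
have r01 : 0 < rho <= 1 by rewrite rho0 ltW.
have [X hX] := annulus_cover lf M' a'0 r01.
apply: (small X) => [x y h|x /vM /hX //].
by apply: ve; exact: lt_trans h re'.
Qed.

End Mirabolic.
End AdditiveCharacters.

(** * Self-duality of the additive group of F *)

Section AdditiveDuality.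
Variables (R : realType) (F : fieldType) (abs : F -> R).
Hypothesis lf : local_field abs.
Let ua := local_field_ultrametric lf.
Let absM := lf_absM lf.
Let abs_ge0 := lf_abs_ge0 lf.

(* If eta differed from all psi(d y0 x), then summing all the vanishing sums
   sum_x eta(x) psi(- d x y0) over d would leave only the term x = 0. *)
Lemma residue_char_dual psi (eta : F -> R[i]) y0 :
  add_char abs psi -> psi y0 != 1 -> (forall y, abs y < abs y0 -> psi y = 1) ->
  (forall x y, abs x <= 1 -> abs y <= 1 -> eta (x + y) = eta x * eta y) ->
  (forall x, abs x < 1 -> eta x = 1) ->
  exists2 d, abs d <= 1 & forall x, abs x <= 1 -> eta x = psi (d * y0 * x).
Proof.
move=> ac py0 hy0 etaD eta1; have [w [s [_ rs _]]] := lf_normalized lf.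
have [us sO srep] := rs.
pose S d := \sum_(x <- s) eta x * psi (- (d * x * y0)).
have [[d ds /eqP Sd]|nS] := pselect (exists2 d, d \in s & S d <> 0).
  exists d; first exact: sO.
  have dO := sO _ ds; move=> x xO; apply: contrapT => ne.
  move: Sd; rewrite /S.
  rewrite (residue_sum0 lf (chi := fun x => eta x * psi (- (d * x * y0))) (u := x)) //.
  - by rewrite eqxx.
  - move=> a b aO bO; rewrite etaD // mulrACA -(add_charD ac); congr (_ * psi _).
    by ring.
  - move=> a a1; rewrite eta1 // mul1r hy0 // (abs_N ua) !absM gtr_pMl.
      by rewrite (le_lt_trans _ a1) // ler_piMl.
    by rewrite (abs_gt0 ua); apply: contraNneq py0 => ->; rewrite (add_char0 ac).
  - apply/eqP => h; apply: ne; apply: (mulIf (add_char_neq0 ac (- (d * x * y0)))).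
    rewrite h -(add_charD ac) (_ : _ + _ = 0) ?(add_char0 ac) //; by ring.
have : \sum_(d <- s) S d = 0.
  rewrite big_seq big1 // => d ds; apply: contrapT => h; apply: nS.
  by exists d.
rewrite /S exchange_big /=.
have y0N0 : y0 != 0 by apply: contraNneq py0 => ->; rewrite (add_char0 ac).
(* The representative of the zero class may differ from 0, but eta is 1 on it. *)
have [r0 [[r0s hr0] r0u]] : exists! x, x \in s /\ abs (0 - x) < 1.
  by apply: srep; rewrite (abs_0 ua) ler01.
rewrite (bigD1_seq r0) //= [X in _ + X]big1_seq ?addr0 => [|x /andP[xr0 xs]].
  rewrite -mulr_sumr; under eq_bigr => d _ do rewrite -mulrA -mulrN.
  rewrite (residue_sum_add_char lf ac py0 hy0 rs).
    rewrite (abs_N ua) absM gtr_pMl ?(abs_gt0 ua) //.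
    rewrite sub0r (abs_N ua) in hr0; rewrite hr0 eta1 // mul1r => /eqP.
    by rewrite (negbTE (residue_system_size lf rs)).
  by rewrite (abs_N ua) absM ler_piMl ?sO.
rewrite -mulr_sumr; under eq_bigr => d _ do rewrite -mulrA -mulrN.
rewrite (residue_sum_add_char lf ac py0 hy0 rs); last first.
  by rewrite (abs_N ua) absM ler_piMl ?sO.
rewrite (abs_N ua) absM gtr_pMl ?(abs_gt0 ua) //.
case: ifP => h; last by rewrite mulr0.
by move: xr0; rewrite (r0u x) ?eqxx // sub0r (abs_N ua).
Qed.

(** c is the limit of approximations c n for which psi' and psi(c n x) agree on balls of radius |z0
    / w^n|, which exhaust F. Passing to the next ball, the two differ by a character of the residue
    field, which [residue_char_dual] absorbs into a correction of c n; these corrections decay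
    geometrically. *)
Lemma add_char_scale psi psi' :
  nontrivial_add_char abs psi -> nontrivial_add_char abs psi' ->
  exists2 c, c != 0 & forall x, psi' x = psi (c * x).
Proof.
move=> nc [ac' [x1 px1]]; have [ac _] := nc.
have [y0 [y00 py0 hy0]] := add_char_conductor lf nc.
have [w uw] := exists_uniformizer lf; have [w0 _ _] := uw.
have /andP[aw0 aw1] := uniformizer_abs lf uw.
have [_ _ [e' e'0 he']] := ac'.
have [z0 z00 ze'] := exists_small lf e'0.
pose t n := z0 / w ^+ n.
have t0 n : t n != 0 by rewrite mulf_neq0 // invr_eq0 expf_neq0.
have at0 n : 0 < abs (t n) by rewrite (abs_gt0 ua).
have tS n : t n = t n.+1 * w by rewrite /t exprS; field; rewrite w0 expf_neq0.
pose Q n c := forall x, abs x <= abs (t n) -> psi' x = psi (c * x).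
have Q0 : Q 0%N 0.
  move=> x xt; rewrite mul0r (add_char0 ac) he' //; apply: le_lt_trans xt _.
  by rewrite /t expr0 divr1.
have /choice[f hf] (p : nat * F) : exists c', Q p.1 p.2 ->
    Q p.1.+1 c' /\ abs (c' - p.2) <= abs (y0 / t p.1.+1).
  case: p => n c /=; have [Qnc|nQ] := pselect (Q n c); last by exists 0.
  (* The discrepancy on the next ball, rescaled to |x| <= 1. It is trivial for |x| < 1, where the
     two characters already agree. *)
  pose eta x := psi' (t n.+1 * x) * psi (- (c * (t n.+1 * x))).
  have [x y _ _|x xlt1|d dO hd] := @residue_char_dual psi eta y0 ac py0 hy0.
  - rewrite /eta mulrDr (add_charD ac') mulrDr opprD (add_charD ac).
    by rewrite mulrACA.
  - have xt : abs (t n.+1 * x) <= abs (t n).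
      rewrite (tS n) !(absM (t n.+1)) ler_wpM2l ?abs_ge0 //.
      by have [_ _ h] := uw; exact: h.
    by rewrite /eta (Qnc _ xt) mulrC (add_charNM ac).
  exists (c + d * y0 / t n.+1) => _; split.
    move=> x xt; have := hd (x / t n.+1).
    rewrite absM (abs_V ua) ler_pdivrMr // mul1r => /(_ xt).
    rewrite /eta (mulrC (t n.+1)) divfK // => h.
    apply: (mulIf (add_char_neq0 ac (- (c * x)))); rewrite h -(add_charD ac).
    by congr psi; field.
  by rewrite addrAC subrr add0r -mulrA absM ler_piMl.
pose c := fix c n := if n is m.+1 then f (m, c m) else 0.
have Qc n : Q n (c n) by elim: n => //= n IH; have [] := hf (n, c n) IH.
have cdiff n : abs (c n.+1 - c n) <= abs (y0 / z0 * w) * abs w ^+ n.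
  have [_] := hf (n, c n) (Qc n); rewrite /= => h; apply: le_trans h _.
  rewrite -(abs_X ua) -absM /t (_ : y0 / _ = y0 / z0 * w * w ^+ n) //.
  by rewrite exprS; field; rewrite z00 /= expf_neq0 // w0.
have rho01 : 0 <= abs w < 1 by rewrite ltW.
have [l hl] := geometric_limit ua (lf_complete lf) rho01 cdiff.
have ct n x : t n = x -> y0 / z0 * w * w ^+ n * x = y0 * w.
  by move=> <-; rewrite /t; field; rewrite z00 expf_neq0.
have main x : psi' x = psi (l * x).
  have [n xn] : exists n, abs x <= abs (t n).
    have [||n /(_ n (leqnn _)) hn] := @expr_lt_eps _ (abs w) (abs z0 / (1 + abs x)).
    - by [].
    - by rewrite divr_gt0 ?(abs_gt0 ua) // ltr_pwDl.
    exists n; rewrite /t absM (abs_V ua) (abs_X ua) ler_pdivlMr ?exprn_gt0 //.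
    move: hn; rewrite ltr_pdivlMr ?ltr_pwDl // mulrDr mulr1 => hn.
    rewrite mulrC; apply/ltW/(le_lt_trans _ hn).
    by rewrite lerDr exprn_ge0.
  rewrite (Qc n x xn) -[l](subrK (c n)) mulrDl (add_charD ac).
  (* On the ball of index n, replacing c n by the limit changes the argument by less than |y0|,
     where psi is trivial. *)
  rewrite (hy0 ((l - c n) * x)) ?mul1r // absM.
  apply: (@le_lt_trans _ _ (abs (y0 * w))); last first.
    by rewrite absM gtr_pMr // (abs_gt0 ua).
  rewrite -(ct n _ erefl) absM ler_pM //.
  by apply: le_trans (hl n) _; rewrite -(abs_X ua) -absM.
exists l => //; apply: contraNneq px1 => l0.
by rewrite main l0 mul0r (add_char0 ac).
Qed.

End AdditiveDuality.

(** * Matrices of size two *)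

Section GL2Theory.
Variable F : fieldType.

Lemma ord2P (P : 'I_2 -> Prop) : P 0 -> P 1 -> forall i, P i.
Proof.
move=> P0 P1 i; have [->//|] : i = 0 \/ i = 1; last by move=> ->.
by case: i => -[|[|//]] h; [left|right]; apply: val_inj.
Qed.

Lemma mx2E (M : 'M[F]_2) : M = mx2 (M 0 0) (M 0 1) (M 1 0) (M 1 1).
Proof.
by apply/matrixP; apply: ord2P; apply: ord2P; rewrite mxE.
Qed.

Lemma mx2M (a b c d a' b' c' d' : F) :
  mx2 a b c d *m mx2 a' b' c' d' =
  mx2 (a * a' + b * c') (a * b' + b * d') (c * a' + d * c') (c * b' + d * d').
Proof.
apply/matrixP; apply: ord2P; apply: ord2P;
  by rewrite !mxE !big_ord_recl big_ord0 !mxE /= addr0.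
Qed.

Lemma det_mx2 (a b c d : F) : \det (mx2 a b c d) = a * d - b * c.
Proof.
rewrite (expand_det_row _ 0) !big_ord_recl big_ord0 /cofactor !det_mx11 !mxE /=.
by rewrite addr0 expr0 mul1r expr1 mulN1r mulrN.
Qed.

Lemma det_gl2_neq0 (g : GL2 F) : \det (gl2_mx g) != 0.
Proof. by have := gl2_unit g; rewrite unitmxE unitfE. Qed.

Lemma gl2_ext (g h : GL2 F) : gl2_mx g = gl2_mx h -> g = h.
Proof. exact: val_inj. Qed.

(** Singular entries yield the identity, so facts about the matrix itself carry a determinant
    hypothesis. *)
Definition gl (a b c d : F) : GL2 F := insubd (1%g : GL2 F) (mx2 a b c d).

Lemma gl_mx (a b c d : F) : a * d - b * c != 0 -> gl2_mx (gl a b c d) = mx2 a b c d.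
Proof. by move=> h; apply: (insubdK (1%g : GL2 F)); rewrite unfold_in unitmxE unitfE det_mx2. Qed.

Lemma gl_eqP (g : GL2 F) (a b c d : F) : gl2_mx g = mx2 a b c d -> g = gl a b c d.
Proof. by rewrite /gl => <-; rewrite -[RHS]/(insubd _ (\val g)) valKd. Qed.

Lemma gl2_mulE (g h : GL2 F) : gl2_mx (g * h)%g = gl2_mx g *m gl2_mx h.
Proof. by []. Qed.

Definition dg (x : F) := gl x 0 0 1.
Definition un (b : F) := gl 1 b 0 1.
Definition sc (x : F) := gl x 0 0 x.
Definition we := gl 0 1 (-1) 0.

Lemma dg_mx x : x != 0 -> gl2_mx (dg x) = mx2 x 0 0 1.
Proof. by move=> x0; rewrite gl_mx // mulr1 mulr0 subr0. Qed.
Lemma un_mx b : gl2_mx (un b) = mx2 1 b 0 1.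
Proof. by rewrite gl_mx // mulr1 mulr0 subr0 oner_neq0. Qed.
Lemma sc_mx x : x != 0 -> gl2_mx (sc x) = mx2 x 0 0 x.
Proof. by move=> x0; rewrite gl_mx // mulr0 subr0 mulf_neq0. Qed.
Lemma we_mx : gl2_mx we = mx2 0 1 (-1) 0.
Proof. by rewrite gl_mx // mulr0 mulrN1 sub0r opprK oner_neq0. Qed.

Lemma dgM x y : x != 0 -> y != 0 -> (dg x * dg y)%g = dg (x * y).
Proof.
move=> x0 y0; apply: gl_eqP; rewrite gl2_mulE !dg_mx // mx2M.
by congr mx2; ring.
Qed.

Lemma dg_un x b : x != 0 -> (dg x * un b)%g = (un (b * x) * dg x)%g.
Proof.
move=> x0; apply: gl2_ext; rewrite !gl2_mulE dg_mx // !un_mx !mx2M.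
by congr mx2; ring.
Qed.

(** The torus part is written as a scalar times [dg], on which the action is prescribed. The
    argument of [dg] is the determinant up to a square, hence a norm when the determinant is one. *)
Lemma bruhat_big (a b c d : F) : c != 0 -> a * d - b * c != 0 ->
  gl a b c d = (un (a / c) * (sc (- c) * (dg ((a * d - b * c) / c ^+ 2) * (we * un (d / c)))))%g.
Proof.
move=> c0 D0; apply/esym/gl_eqP; rewrite !gl2_mulE !un_mx we_mx.
rewrite sc_mx ?oppr_eq0 // dg_mx ?mulf_neq0 ?invr_eq0 ?expf_neq0 // !mx2M.
by congr mx2; field.
Qed.

Lemma bruhat_small (a b d : F) : a != 0 -> d != 0 ->
  gl a b 0 d = (un (b / d) * (sc d * dg (a / d)))%g.
Proof.
move=> a0 d0; apply/esym/gl_eqP; rewrite !gl2_mulE !un_mx sc_mx //.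
rewrite dg_mx ?mulf_neq0 ?invr_eq0 // !mx2M.
by congr mx2; field.
Qed.

(** Unlike [bruhat_big], this decomposition covers a neighbourhood of 1. *)
Lemma big_cell (a b c d : F) : a != 0 -> a * d - b * c != 0 ->
  gl a b c d = (we^-1 * (un (- (c / a)) * (we * (sc ((a * d - b * c) / a) *
     (dg (a ^+ 2 / (a * d - b * c)) * un (b / a))))))%g.
Proof.
move=> a0 D0; apply: (mulgI we); rewrite mulKVg; apply: gl2_ext.
rewrite !gl2_mulE !un_mx we_mx gl_mx // sc_mx ?mulf_neq0 ?invr_eq0 //.
rewrite dg_mx ?mulf_neq0 ?invr_eq0 ?expf_neq0 // !mx2M.
by congr mx2; field; rewrite ?a0 ?D0.
Qed.

Lemma weyl_relation : (we * (un 1 * we))%g = (sc (-1) * (un (-1) * (we * un (-1))))%g.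
Proof.
apply: gl2_ext; rewrite !gl2_mulE !un_mx we_mx sc_mx ?oppr_eq0 ?oner_eq0 // !mx2M.
by congr mx2; ring.
Qed.

Lemma dg_conj_we c : c != 0 ->
  (dg c * we * (dg c)^-1)%g = (gl c 0 0 c^-1 * we)%g.
Proof.
move=> c0; apply: (mulIg (dg c)); rewrite mulgKV; apply: gl2_ext.
rewrite !gl2_mulE we_mx !dg_mx // gl_mx ?mulf_neq0 ?divff ?mul0r ?subr0 ?oner_eq0 //.
by rewrite !mx2M; congr mx2; field.
Qed.

Lemma dg_conj_un c b : c != 0 -> (dg c * un b * (dg c)^-1)%g = un (c * b).
Proof. by move=> c0; rewrite dg_un // mulgK mulrC. Qed.

Lemma dg_conj_sc c x : c != 0 -> x != 0 -> (dg c * sc x * (dg c)^-1)%g = sc x.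
Proof.
move=> c0 x0; apply: (mulIg (dg c)); rewrite mulgKV; apply: gl2_ext.
by rewrite !gl2_mulE !dg_mx // !sc_mx // !mx2M; congr mx2; ring.
Qed.

Lemma dg_conj_dg c x : c != 0 -> x != 0 -> (dg c * dg x * (dg c)^-1)%g = dg x.
Proof. by move=> c0 x0; apply: (mulIg (dg c)); rewrite mulgKV !dgM // mulrC. Qed.

Variable E : splittingFieldType F.

Lemma det_gl2V (g : GL2 F) : \det (gl2_mx (g^-1)%g) = (\det (gl2_mx g))^-1.
Proof. by rewrite -[gl2_mx _]/(invmx (gl2_mx g)) det_inv. Qed.

Lemma det_gl2M (g h : GL2 F) : \det (gl2_mx (g * h)%g) = \det (gl2_mx g) * \det (gl2_mx h).
Proof. by rewrite gl2_mulE det_mulmx. Qed.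

Let GL2NE (g : GL2 F) : GL2N E g = norm_group E (\det (gl2_mx g)).
Proof. by []. Qed.

Hypothesis Ng : mult_subgroup (norm_group E).

Lemma GL2N_mul (g h : GL2 F) : GL2N E g -> GL2N E h -> GL2N E (g * h)%g.
Proof. by rewrite !GL2NE det_gl2M; case: Ng => _ + _ _; apply. Qed.

Lemma GL2N_inv (g : GL2 F) : GL2N E g -> GL2N E (g^-1)%g.
Proof. by rewrite !GL2NE det_gl2V; case: Ng => _ _ + _; apply. Qed.

Lemma GL2N_un b : GL2N E (un b).
Proof. by rewrite !GL2NE un_mx det_mx2 mulr1 mulr0 subr0; case: Ng. Qed.

Lemma GL2N_we : GL2N E we.
Proof. by rewrite !GL2NE we_mx det_mx2 mulr0 mulrN1 sub0r opprK; case: Ng. Qed.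

Lemma GL2N_dg x : norm_group E x -> GL2N E (dg x).
Proof.
move=> Nx; have x0 : x != 0 by case: Ng => _ _ _; apply.
by rewrite !GL2NE dg_mx // det_mx2 mulr1 mulr0 subr0.
Qed.

Lemma GL2N_conj (g h : GL2 F) : GL2N E h -> GL2N E (g * h * g^-1)%g.
Proof.
rewrite !GL2NE !det_gl2M det_gl2V mulrC mulKf //; exact: det_gl2_neq0.
Qed.

Lemma GL2N_dg_decomp (g : GL2 F) : exists2 h, GL2N E h & g = (h * dg (\det (gl2_mx g)))%g.
Proof.
exists (g * (dg (\det (gl2_mx g)))^-1)%g; last by rewrite mulgKV.
have D0 := det_gl2_neq0 g.
rewrite !GL2NE det_gl2M det_gl2V dg_mx // det_mx2 mulr1 mulr0 subr0 divff //.
by case: Ng.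
Qed.

End GL2Theory.

(** * Elementary facts on representations *)

Section RepFacts.
Variables (C : fieldType) (G : groupType) (H : set G) (W : lmodType C) (V : set W).
Variable rho : G -> W -> W.
Hypothesis r : is_rep H V rho.

Lemma rep_zero h : H h -> rho h 0 = 0.
Proof.
move=> Hh; have [V0 _] := rep_subspace r; have := rep_linear r Hh (-1) V0 V0.
by rewrite scaler0 addr0 scaleN1r addNr.
Qed.

Lemma rep_scale h a v : H h -> V v -> rho h (a *: v) = a *: rho h v.
Proof.
move=> Hh Vv; have [V0 _] := rep_subspace r; have := rep_linear r Hh a Vv V0.
by rewrite rep_zero // !addr0.
Qed.

Lemma rep_neq0 h v : H h -> H h^-1%g -> V v -> v <> 0 -> rho h v <> 0.
Proof.
move=> Hh HV Vv v0 hv; apply: v0; rewrite -(rep_one r Vv) -(mulVg h).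
by rewrite (rep_mul r) // hv rep_zero.
Qed.

End RepFacts.

(** * Irreducibility of the induced representation *)

Lemma hilbert_symbol_sqr (F : fieldType) (y b : F) : hilbert_symbol (y ^+ 2) b = 1.
Proof.
rewrite /hilbert_symbol asboolT //; exists 1, 0, y; split.
  by case=> /eqP; rewrite oner_eq0.
by rewrite expr1n mulr1 expr0n mulr0 addr0.
Qed.

Section InducedWeilRepresentation.
Local Open Scope complex_scope.
Variables (R : realType) (F : fieldType) (abs : F -> R).
Variables (E : splittingFieldType F) (Delta : F) (delta : E) (sigma : gal_of {:E}).
Variables (Theta : E -> R[i]) (psi : F -> R[i]).
Variables (mu : {measure set (borel (@absE F E R abs)) -> \bar R}).
Variable rho : GL2 F -> (E -> R[i]^o) -> (E -> R[i]^o).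
Hypotheses (lf : local_field abs) (ch0 : [pchar F] =i pred0).
Hypotheses (sG : sigma \in 'Gal({:E} / 1)%g) (sigma1 : sigma != 1%g).
Hypothesis ap : admissible_pair abs Delta delta Theta.
Hypothesis nc : nontrivial_add_char abs psi.
Hypothesis P : is_pi_Theta Delta sigma Theta psi mu rho.

Let qe : quadratic_ext Delta delta. Proof. by case: ap. Qed.
Let mcT : mult_char (absE abs) Theta. Proof. by case: ap. Qed.
Let ua := local_field_ultrametric lf.
Let uaE := absE_ultrametric qe sG sigma1 lf.
Let ac : add_char abs psi. Proof. by case: nc. Qed.
Let Ng : mult_subgroup (norm_group E) := mult_subgroup_norm sG sigma1 ap.
Let absM := lf_absM lf.
Let absE_ge0 (z : E) : 0 <= absE abs z. Proof. by case: uaE. Qed.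

Let absEM (y z : E) : absE abs (y * z) = absE abs y * absE abs z.
Proof. by case: uaE. Qed.

Local Notation V := (schwartz_theta abs Theta).
Local Notation H := (GL2N E).

Let Pr := pi_rep P.
Let V_stable h v : H h -> V v -> V (rho h v). Proof. by move=> Hh Vv; exact: (rep_stable Pr). Qed.
Let rho_mul g h v : H g -> H h -> V v -> rho (g * h)%g v = rho g (rho h v).
Proof. by move=> Hg Hh Vv; exact: (rep_mul Pr). Qed.
Let rho1 v : V v -> rho 1%g v = v. Proof. by move=> Vv; exact: (rep_one Pr). Qed.

Lemma pi_un_fix v : V v -> exists2 e, 0 < e &
  forall b, abs b < e -> rho (un b) v = v.
Proof.
move=> Vv; have [e [M [_ _ vM]]] := schwartz_theta_uniform lf sG sigma1 ap Vv.
have [_ _ [e1 e10 he1]] := ac.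
have M0 : 0 < Num.max M 1 by rewrite lt_max ltr01 orbT.
exists (e1 / Num.max M 1); first by rewrite divr_gt0.
move=> b be; apply/funext => z; rewrite (pi_unipotent P z (un_mx b) Vv).
have [->|/eqP/vM zM] := eqVneq (v z) 0; first by rewrite mulr0.
rewrite he1 ?mul1r // absM; move: be; rewrite ltr_pdivlMr //; apply: le_lt_trans.
by rewrite ler_wpM2l ?(lf_abs_ge0 lf) // le_max zM.
Qed.

(** Near 1, x is a square, so the Hilbert symbol is 1, and Theta is trivial by smoothness. *)
Lemma pi_sc_fix : exists2 e, 0 < e & forall x v, V v -> abs (x - 1) < e ->
  [/\ x != 0, H (sc x) & rho (sc x) v = v].
Proof.
have [d1 d10 hd1] := Theta_alg_near1 lf sG sigma1 ap.
have [d2 d20 hd2] := sqrt_near1 lf ch0 ltr01.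
exists (Num.min (Num.min d1 d2) 1); first by rewrite !lt_min d10 d20 ltr01.
move=> x v Vv; rewrite !lt_min => /andP[/andP[x1 x2] x3].
have x0 := near1_neq0 ua x3.
have Hx : H (sc x).
  by rewrite /GL2N /= sc_mx // det_mx2 mulr0 subr0; exact: norm_group_sqr sG sigma1 ap x x0.
split=> //; apply/funext => z; rewrite (pi_central P z x0 (sc_mx x0) Vv).
rewrite hd1 //; have [y <- _] := hd2 x x2.
by rewrite hilbert_symbol_sqr !mul1r.
Qed.

Lemma pi_dg_fix v : V v -> exists2 e, 0 < e & forall x, abs (x - 1) < e ->
  [/\ x != 0, H (dg x) & rho (dg x) v = v].
Proof.
move=> Vv; have [e [M [e0 vc vM]]] := schwartz_theta_uniform lf sG sigma1 ap Vv.
have M0 : 0 < Num.max M 1 by rewrite lt_max ltr01 orbT.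
have [d1 d10 hd1] := Theta_alg_near1 lf sG sigma1 ap.
have [d2 d20 hd2] := absE_alg_near1 lf sG sigma1 ap (divr_gt0 e0 M0).
have d0 : 0 < Num.min (Num.min d1 d2) 1 by rewrite !lt_min d10 d20 ltr01.
have [d dd0 hd] := sqrt_near1 lf ch0 d0.
exists d => // x /hd[y yx]; rewrite !lt_min => /andP[/andP[y1 y2] y3].
have ay := abs_near1 ua y3; have y0 := near1_neq0 ua y3.
have x0 : x != 0 by rewrite -yx expf_neq0.
have nx : nrm (y%:A : E) = x by rewrite (nrm_alg qe sG sigma1).
have Ey0 : y%:A != 0 :> E by rewrite scaler_eq0 oner_eq0 orbF.
have Hx : H (dg x) by apply: GL2N_dg => //; exists y%:A.
split=> //; apply/funext => z.
rewrite (pi_norm P z Ey0 _ Vv) ?nx ?dg_mx // hd1 // mul1r -yx (abs_X ua) ay.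
rewrite expr1n sqrtr1 mul1r gal_alg mulr_algl.
have main t : v t <> 0 -> v (y *: t) = v t.
  move=> /vM tM; apply: vc.
  have -> : y *: t - t = (y%:A - 1) * t by rewrite mulrBl mul1r mulr_algl.
  rewrite absEM.
  have := hd2 y y2; rewrite ltr_pdivlMr //; apply: le_lt_trans.
  by rewrite ler_wpM2l // le_max tM.
have [vz|/eqP] := eqVneq (v z) 0; last exact: main.
rewrite vz; apply: contrapT => h.
(* Here only y z is known to lie in the support; z obeys the same bound because |y| = 1. *)
have vyz : absE abs (y *: z) <= M by exact: vM.
apply: h; rewrite (_ : v (y *: z) = v z) //; apply: vc.
have -> : y *: z - z = (y%:A - 1) * z by rewrite mulrBl mul1r mulr_algl.
rewrite absEM.
have := hd2 y y2; rewrite ltr_pdivlMr //; apply: le_lt_trans.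
rewrite ler_wpM2l // le_max.
by move: vyz; rewrite (absE_scale qe sG sigma1 lf) ay expr1n mul1r => ->.
Qed.

Lemma gl_eq_entries (g : GL2 F) :
  g = gl (gl2_mx g 0 0) (gl2_mx g 0 1) (gl2_mx g 1 0) (gl2_mx g 1 1).
Proof. by apply: gl_eqP; exact: mx2E. Qed.

(* Through the big cell: lower unipotents are w^-1 u w, and the diagonal factors
   are close to 1, hence squares. *)
Lemma pi_smooth v : V v -> exists2 e, 0 < e & forall k : GL2 F,
  (forall i j, abs (gl2_mx k i j - (i == j)%:R) < e) -> H k /\ rho k v = v.
Proof.
move=> Vv; have Hw : H (we F) by exact: GL2N_we.
have Hwv : H (we F)^-1%g by exact: GL2N_inv.
have [e1 e10 h1] := pi_un_fix Vv.
(* A lower unipotent fixes v when the corresponding upper one fixes [rho (we F) v]. *)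
have [e2 e20 h2] := pi_un_fix (V_stable Hw Vv).
have [e3 e30 h3] := pi_sc_fix.
have [e4 e40 h4] := pi_dg_fix Vv.
pose m := Num.min (Num.min (Num.min e1 e2) (Num.min e3 e4)) 1.
have m0 : 0 < m by rewrite !lt_min e10 e20 e30 e40 ltr01.
have [m1 m2 m3 m4 mm] : [/\ m <= e1, m <= e2, m <= e3, m <= e4 & m <= 1].
  by rewrite /m; split; rewrite !ge_min lexx ?orbT.
exists m => // k hk; rewrite (gl_eq_entries k).
move: (hk 0 0) (hk 0 1) (hk 1 0) (hk 1 1); rewrite !eqxx /= !subr0.
set a := gl2_mx k 0 0; set b := gl2_mx k 0 1.
set c := gl2_mx k 1 0; set d := gl2_mx k 1 1 => ha hb hc hd.
have a1 := abs_near1 ua (lt_le_trans ha mm).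
have a0 := near1_neq0 ua (lt_le_trans ha mm).
have hD : abs (a * d - b * c - 1) < m.
  rewrite addrAC (abs_sub_lt ua) //; first exact: (near1_mul ua).
  rewrite absM (le_lt_trans _ hc) // ler_piMl ?(lf_abs_ge0 lf) //.
  exact/ltW/(lt_le_trans hb).
have D0 := near1_neq0 ua (lt_le_trans hD mm).
rewrite (big_cell a0 D0).
have hDa : abs ((a * d - b * c) / a - 1) < m.
  by rewrite (near1_mul ua) // (near1_inv ua).
have haD : abs (a ^+ 2 / (a * d - b * c) - 1) < m.
  by rewrite (near1_mul ua) ?(near1_inv ua) // expr2 (near1_mul ua).
have hb' : abs (b / a) < e1 by rewrite absM (abs_V ua) a1 invr1 mulr1 (lt_le_trans hb).
have hc' : abs (- (c / a)) < e2.
  by rewrite (abs_N ua) absM (abs_V ua) a1 invr1 mulr1 (lt_le_trans hc).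
have [_ Hs fs] := h3 _ v Vv (lt_le_trans hDa m3).
have [_ Hd fd] := h4 _ (lt_le_trans haD m4).
have Hu x : H (un x) by exact: GL2N_un.
have HM := GL2N_mul Ng.
have r5 : H (dg (a ^+ 2 / (a * d - b * c)) * un (b / a))%g by exact: HM.
have r4 := HM _ _ Hs r5.
have r3 := HM _ _ Hw r4.
have r2 := HM _ _ (Hu (- (c / a))) r3.
split; first exact: HM.
rewrite (rho_mul Hwv r2 Vv) (rho_mul (Hu _) r3 Vv) (rho_mul Hw r4 Vv).
rewrite (rho_mul Hs r5 Vv) (rho_mul Hd (Hu _) Vv) (h1 _ hb') fd fs (h2 _ hc').
by rewrite -(rho_mul Hwv Hw Vv) mulVg rho1.
Qed.

Local Notation IndV := (Ind abs H V rho).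

Lemma gl2_mx_bound (g : GL2 F) : exists2 B, 0 < B & forall i j, abs (gl2_mx g i j) <= B.
Proof.
exists (1 + \sum_i \sum_j abs (gl2_mx g i j)).
  by rewrite ltr_wpDr // sumr_ge0 // => i _; rewrite sumr_ge0 // => j _; exact: lf_abs_ge0.
move=> i j; rewrite (bigD1 i) //= (bigD1 j) //= addrCA -!addrA lerDl.
rewrite addr_ge0 //; first by rewrite sumr_ge0 // => ? _; exact: lf_abs_ge0.
rewrite addr_ge0 // sumr_ge0 // => ? _; rewrite sumr_ge0 // => ? _; exact: lf_abs_ge0.
Qed.

(** Conjugation is continuous at 1, so a right translate of a smooth function is smooth. The
    estimate comes from g^-1 k g - 1 = g^-1 (k - 1) g. *)
Lemma gl2_conj_near1 (g : GL2 F) (e : R) : 0 < e -> exists2 d, 0 < d &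
  forall k : GL2 F, (forall i j, abs (gl2_mx k i j - (i == j)%:R) < d) ->
    forall i j, abs (gl2_mx (g^-1 * (k * g))%g i j - (i == j)%:R) < e.
Proof.
move=> e0; have [B B0 hB] := gl2_mx_bound g; have [B' B'0 hB'] := gl2_mx_bound g^-1%g.
have BB0 : 0 < B' * B by rewrite mulr_gt0.
exists (e / (B' * B)); first by rewrite divr_gt0.
move=> k hk i j.
have -> : gl2_mx (g^-1 * (k * g))%g i j - (i == j)%:R =
    (gl2_mx g^-1%g *m ((gl2_mx k - 1%:M) *m gl2_mx g)) i j.
  by rewrite mulmxBl mul1mx mulmxBr mulVmx ?gl2_unit // !mxE.
rewrite mxE; have sumlt (f : 'I_2 -> F) : (forall l, abs (f l) < e) -> abs (\sum_l f l) < e.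
  by move=> hf; rewrite !big_ord_recl big_ord0 addr0 (abs_add_lt ua).
apply: (sumlt) => a; rewrite mxE mulr_sumr; apply: sumlt => b.
have kd : abs ((gl2_mx k - 1%:M) a b) < e / (B' * B) by rewrite !mxE; exact: hk.
move: kd; rewrite ltr_pdivlMr // !absM; apply: le_lt_trans.
rewrite mulrCA ler_wpM2l ?(lf_abs_ge0 lf) //.
by rewrite ler_pM ?(lf_abs_ge0 lf).
Qed.

Lemma is_rep_Ind : is_rep [set: GL2 F] IndV (@right_translation F (E -> R[i]^o)).
Proof.
have [V0 VD] := rep_subspace Pr.
split=> //.
- split.
    split=> [g|h g Hh|]; [exact: V0|by rewrite (rep_zero Pr Hh)|by exists 1].
  move=> a f g [Vf Hf [e e0 he]] [Vg Hg [d d0 hd]].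
  split=> [x|h x Hh|]; first exact: VD.
    by rewrite /= (rep_linear Pr Hh) //; congr (_ *: _ + _); [exact: Hf|exact: Hg].
  exists (Num.min e d); first by rewrite lt_min e0.
  move=> k hk x; congr (_ *: _ + _); [apply: he|apply: hd] => i j;
    by have := hk i j; rewrite lt_min => /andP[].
- move=> g f _ [Vf Hf [e e0 he]]; split=> [x|h x Hh|]; first exact: Vf.
    by rewrite /right_translation -mulgA; exact: Hf.
  have [d d0 hd] := gl2_conj_near1 g e0; exists d => // k hk x.
  have {}hk := he _ (hd k hk).
  by rewrite /right_translation -(hk (x * g)%g) !mulgA mulgK.
- by move=> f _; apply/funext => x; rewrite /right_translation mulg1.
- by move=> g h f _ _ _; apply/funext => x; rewrite /right_translation mulgA.
Qed.

(** h |-> rho h v, extended by 0 outside [GL2N]. Its smoothness is [pi_smooth], which also places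
    the small k in [GL2N]. *)
Lemma Ind_neq0 : exists2 f, IndV f & f != 0.
Proof.
have [v Vv v0] := schwartz_theta_neq0 lf ch0 sG sigma1 ap.
pose f (g : GL2 F) : E -> R[i]^o := if `[< H g >] then rho g v else 0.
have fH g : H g -> f g = rho g v by move=> Hg; rewrite /f asboolT.
have fN g : ~ H g -> f g = 0 by move=> Hg; rewrite /f asboolF.
have H1 : H 1%g by rewrite /GL2N /= det1; case: Ng.
have HMr g k : H k -> H (g * k)%g <-> H g.
  move=> Hk; split=> [h|Hg]; last exact: GL2N_mul.
  by have := GL2N_mul Ng h (GL2N_inv Ng Hk); rewrite mulgK.
have HMl k g : H k -> H (k * g)%g <-> H g.
  move=> Hk; split=> [h|Hg]; last exact: GL2N_mul.
  by have := GL2N_mul Ng (GL2N_inv Ng Hk) h; rewrite mulKg.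
exists f; last first.
  apply/eqP => /(congr1 (fun f => f 1%g)); rewrite fH // rho1 //.
split=> [g|h g Hh|].
- by have [Hg|Hg] := pselect (H g); [rewrite fH //; exact: V_stable|rewrite fN //; case: (rep_subspace Pr)].
- have [Hg|Hg] := pselect (H g); first by rewrite !fH ?rho_mul //; exact: GL2N_mul.
  by rewrite !fN ?(rep_zero Pr Hh) // => /(HMl _ _ Hh).
have [e e0 he] := pi_smooth Vv.
exists e => // k /he[Hk fk] g.
have [Hg|Hg] := pselect (H g); last by rewrite !fN // => /(HMr _ _ Hk).
by rewrite !fH ?rho_mul ?fk //; exact: GL2N_mul.
Qed.

(* The Kirillov model; the value 0 at x = 0 stands for the missing dg 0. *)
Definition kir (f : GL2 F -> E -> R[i]^o) (x : F) : R[i] :=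
  if x == 0 then 0 else f (dg x) 1.

Lemma Ind_dg_norm f x zeta z : IndV f -> x != 0 -> zeta != 0 ->
  f (dg (nrm zeta * x)) z =
  Theta zeta * (Num.sqrt (abs (nrm zeta)))%:C * f (dg x) (sigma zeta * z).
Proof.
move=> [Vf Hf _] x0 z0; have n0 : nrm zeta != 0 by rewrite (nrm_eq0 qe sG sigma1).
rewrite -dgM // Hf; last by apply: GL2N_dg => //; exists zeta.
by rewrite (pi_norm P z z0 _ (Vf _)) // dg_mx.
Qed.

(** With zeta = sigma z, [Ind_dg_norm] expresses f(dg x) at z through [kir f] at N(z) x. At z = 0
    all values vanish, and the elements dg x meet every coset of [GL2N]. *)
Lemma kir_inj f g : IndV f -> IndV g -> kir f = kir g -> f = g.
Proof.
move=> If Ig fg; have [Vf Hf _] := If; have [Vg Hg _] := Ig.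
suff dgE x : x != 0 -> f (dg x) = g (dg x).
  apply/funext => y; have [h Hh ->] := GL2N_dg_decomp Ng y.
  by rewrite Hf // Hg // dgE // det_gl2_neq0.
move=> x0; apply/funext => z.
have [->|z0] := eqVneq z 0.
  by rewrite !(schwartz_theta0 lf ch0 sG sigma1 ap).
have sz0 : sigma z != 0 by rewrite fmorph_eq0.
have n0 : nrm (sigma z) != 0 by rewrite (nrm_eq0 qe sG sigma1).
have nx0 : nrm (sigma z) * x != 0 by rewrite mulf_neq0.
have := congr1 (fun u => u (nrm (sigma z) * x)) fg.
rewrite /kir (negbTE nx0) !(Ind_dg_norm _ _ x0 sz0) //.
rewrite mulr1 (sigmaK qe sigma1) => /mulfI; apply.
rewrite mulf_neq0 ?(mult_char_neq0 mcT) //.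
by rewrite fmorph_eq0 gt_eqF // sqrtr_gt0 (abs_gt0 ua).
Qed.

Lemma kir_lin a f g x : kir (a *: f + g) x = a * kir f x + kir g x.
Proof. by rewrite /kir; case: eqP => // _; rewrite mulr0 addr0. Qed.

Lemma kir_un b f : IndV f ->
  kir (right_translation (un b) f) = (fun x => psi (b * x) * kir f x).
Proof.
move=> [Vf Hf _]; apply/funext => x; rewrite /kir /right_translation.
have [_|x0] := eqVneq x 0; first by rewrite mulr0.
rewrite dg_un // Hf; last exact: GL2N_un.
by rewrite (pi_unipotent P _ (un_mx _) (Vf _)) (nrm1 qe sG sigma1) mulr1.
Qed.

Lemma kir_dg y f : y != 0 ->
  kir (right_translation (dg y) f) = (fun x => kir f (x * y)).
Proof.
move=> y0; apply/funext => x; rewrite /kir /right_translation mulf_eq0 (negbTE y0) orbF.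
by have [_|x0] := eqVneq x 0; rewrite // dgM.
Qed.

Lemma dg_near1 (e : R) y : y != 0 -> abs (y - 1) < e ->
  forall i j, abs (gl2_mx (dg y) i j - (i == j)%:R) < e.
Proof.
move=> y0 ye; have e0 : 0 < e by rewrite (le_lt_trans _ ye) // (lf_abs_ge0 lf).
by rewrite dg_mx //; apply: ord2P; apply: ord2P; rewrite mxE /= ?subrr ?subr0 ?(abs_0 ua).
Qed.

Lemma un_near1 (e : R) b : abs b < e ->
  forall i j, abs (gl2_mx (un b) i j - (i == j)%:R) < e.
Proof.
move=> be; have e0 : 0 < e by rewrite (le_lt_trans _ be) // (lf_abs_ge0 lf).
by rewrite un_mx; apply: ord2P; apply: ord2P; rewrite mxE /= ?subrr ?subr0 ?(abs_0 ua).
Qed.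

(** Multiplicative invariance is smoothness under dg y. Near 0: at x = c y^2 the value is a multiple
    of f(dg c) at y, which vanishes for small y, and finitely many c suffice. Far out: f is fixed by
    un b for small b, so psi(b x) = 1 on the support, which b = x1 / x refutes for large x. *)
Lemma kir_kirillov_function f : IndV f -> kirillov_function abs (kir f).
Proof.
move=> If; have [Vf Hf [e e0 he]] := If; have [_ [x1 px1]] := nc.
pose r := Num.min e 1.
have r01 : 0 < r <= 1 by rewrite lt_min e0 ltr01 ge_min lexx orbT.
have rinv x y : abs (y - 1) < r -> kir f (x * y) = kir f x.
  rewrite lt_min => /andP[ye y1]; have y0 := near1_neq0 ua y1.
  have /(congr1 (fun u => u x)) <- := kir_dg f y0.
  rewrite /kir /right_translation; case: eqP => // _.
  by rewrite he //; exact: dg_near1.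
have [X hX] := square_classes lf r01.
have [a a0 ha] : exists2 a, 0 < a & forall c z, c \in X -> c != 0 ->
    abs c * absE abs z < a -> f (dg c) z = 0.
  elim: X {hX} => [|c X [a a0 ha]]; first by exists 1.
  have [ec [M [ec0 hc _]]] := schwartz_theta_uniform lf sG sigma1 ap (Vf (dg c)).
  have [c0|c0] := eqVneq c 0.
    exists a => // d z; rewrite inE => /orP[/eqP->|]; last exact: ha.
    by rewrite c0 eqxx.
  have ac0 : 0 < abs c by rewrite (abs_gt0 ua).
  exists (Num.min a (abs c * ec)); first by rewrite lt_min a0 mulr_gt0.
  move=> d z; rewrite inE lt_min => /orP[/eqP->|dX] d0 /andP[h1 h2]; last exact: ha.
  rewrite (hc z 0) ?subr0; last by move: h2; rewrite ltr_pM2l.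
  exact: schwartz_theta0 lf ch0 sG sigma1 ap _ (Vf _).
exists r, a, (abs x1 / e); split=> //; first by case/andP: r01.
move=> x kx; have x0 : x != 0 by apply/eqP => x0; apply: kx; rewrite /kir x0 eqxx.
have ax : 0 < abs x by rewrite (abs_gt0 ua).
apply/andP; split; rewrite leNgt; apply/negP => hx; apply: kx.
  have [c [y [cX c0 y0 hv]]] := hX x x0.
  have Ey0 : y%:A != 0 :> E by rewrite scaler_eq0 oner_eq0 orbF.
  have cy0 : c * y ^+ 2 != 0 by rewrite mulf_neq0 // expf_neq0.
  have -> : x = c * y ^+ 2 * (x / (c * y ^+ 2)) by rewrite mulrC divfK.
  rewrite rinv // /kir (negbTE cy0) mulrC -(nrm_alg qe sG sigma1 y).
  rewrite (Ind_dg_norm _ If c0 Ey0) mulr1 gal_alg ha ?mulr0 //.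
  rewrite (absE_alg qe sG sigma1 lf) -(abs_X ua) -absM (_ : abs _ = abs x) //.
  have x1' : abs (x / (c * y ^+ 2)) = 1.
    by apply: (abs_near1 ua); case/andP: r01 => _ r1; exact: lt_le_trans hv r1.
  by rewrite -[in RHS](divfK cy0 x) (absM (x / _)) x1' mul1r.
have hb : abs (x1 / x) < e.
  rewrite absM (abs_V ua) ltr_pdivrMr // mulrC -ltr_pdivrMr //.
have /(congr1 (fun u => u x)) := kir_un (x1 / x) If.
rewrite divfK // (_ : right_translation _ f = f); last first.
  by apply/funext => g; rewrite /right_translation he //; exact: un_near1.
move=> /eqP; rewrite -subr_eq0 -[X in X - _]mul1r -mulrBl mulf_eq0 subr_eq0 eq_sym.
by rewrite (negbTE px1) => /eqP.
Qed.

Theorem Ind_irreducible :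
  irreducible_rep [set: GL2 F] IndV (@right_translation F (E -> R[i]^o)).
Proof.
split; [exact: is_rep_Ind|exact: Ind_neq0|].
move=> U [U0 UD] UI Ust.
have [[u Uu u0]|nU] := pselect (exists2 u, U u & u != 0); last first.
  left; apply/seteqP; split=> [u Uu /=|u ->//].
  by apply: contrapT => /eqP u0; apply: nU; exists u.
right; apply/seteqP; split=> // f If.
have Ut g v : U v -> U (right_translation g v) by exact: Ust.
suff [v Uv /(kir_inj (UI _ Uv) If) <- //] : [set kir v | v in U] (kir f).
apply: (mirabolic_full lf nc); last exact: kir_kirillov_function.
- move=> a _ _ [v Uv <-] [v' Uv' <-]; exists (a *: v + v'); first exact: UD.
  by apply/funext => x; rewrite kir_lin.
- move=> b _ [v Uv <-]; exists (right_translation (un b) v); first exact: Ut.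
  by rewrite kir_un //; exact: UI.
- move=> y _ y0 [v Uv <-]; exists (right_translation (dg y) v); first exact: Ut.
  by rewrite kir_dg.
- by move=> _ [v Uv <-]; apply: kir_kirillov_function; exact: UI.
exists (kir u); apply: contrapT => nk; move/eqP: u0; apply.
apply: (kir_inj (UI _ Uu) (UI _ U0)); apply/funext => x.
have -> : kir 0 x = 0 by rewrite /kir if_same.
by apply: contrapT => h; apply: nk; exists x; split=> //; exists u.
Qed.

End InducedWeilRepresentation.

(** * Independence of the additive character *)

Section HaarIntegral.
Variables (R : realType) (K : fieldType) (abs : K -> R).
Hypotheses (ua : ultrametric abs) (tb : totally_bounded abs) (cpl : abs_complete abs).

Definition adic_ball (c : K) (r : R) : set (borel abs) := [set x : K | abs (x - c) < r].

Lemma measurable_adic_ball c r : measurable (adic_ball c r).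
Proof.
apply: sub_sigma_algebra; suff : adic_open (adic_ball c r : set (adic abs)) by [].
move=> x xc; have r0 : 0 < r.
  by apply: le_lt_trans xc; case: ua.
by exists r => // y yx; apply: (abs_dist_lt ua yx).
Qed.

Lemma haar_ball_lty (mu : {measure set (borel abs) -> \bar R}) c r : haar mu ->
  (mu (adic_ball c r) < +oo)%E.
Proof.
move=> [_ hfin _]; pose M := Num.max (Num.max r (abs c)) 1.
have M0 : 0 < M by rewrite lt_max ltr01 orbT.
have cM : compact [set x : adic abs | abs x <= M] by exact: compact_adic_ball.
have mB : measurable ([set x : K | abs x <= M] : set (borel abs)).
  apply: sub_sigma_algebra.
  suff : adic_open ([set x | abs x <= M] : set (adic abs)) by [].
  move=> x xM; exists M => // y yx; rewrite /= -(subrK x y).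
  by rewrite (abs_add_le ua) // ltW.
apply: le_lt_trans (hfin _ cM); apply: le_measure; rewrite ?inE //.
  exact: measurable_adic_ball.
move=> x /= xc; rewrite -(subrK c x) (abs_add_le ua) // /M !le_max ?lexx ?orbT //.
by rewrite ltW.
Qed.

Lemma haar_ball_translate (mu : {measure set (borel abs) -> \bar R}) c r : haar mu ->
  mu (adic_ball c r) = mu (adic_ball 0 r).
Proof.
move=> [htr _ _]; rewrite -(htr _ c (measurable_adic_ball 0 r)); congr (mu _).
apply/seteqP; split=> [x /= xc|_ [y /= yr <-]].
  exists (x - c); first by rewrite /adic_ball /= subr0.
  by rewrite addrC subrK.
by rewrite /adic_ball /= addrAC subrr add0r -[y]subr0.
Qed.

Lemma integrable_indic_lty (mu : {measure set (borel abs) -> \bar R}) (A : set (borel abs)) :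
  measurable A -> (mu A < +oo)%E -> mu.-integrable setT (EFin \o \1_A).
Proof.
move=> mA Afin; apply/integrableP; split; first exact/measurable_realfun.measurable_EFinP.
rewrite (eq_integral (fun x => (\1_A x)%:E)); last first.
  by move=> x _ /=; rewrite ger0_norm.
by rewrite integral_indic // setIT.
Qed.

(* On functions constant on the balls of radius r, the integral for any Haar
   measure is a sum that does not depend on the measure, times the volume of
   such a ball. *)
Lemma haar_Rintegral r (X : seq K) (f : K -> R) :
  (forall x y, abs (x - y) < r -> f x = f y) ->
  (forall x, f x <> 0 -> exists2 c, c \in X & abs (x - c) < r) ->
  exists S : R, forall mu : {measure set (borel abs) -> \bar R}, haar mu ->
    mu.-integrable setT (EFin \o (f : borel abs -> R)) /\
    Rintegral mu setT (f : borel abs -> R) = fine (mu (adic_ball 0 r)) * S.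
Proof.
elim: X f => [|c X IH] f fc fX.
  exists 0 => mu hmu; have -> : f = (fun=> 0).
    by apply/funext => x; apply: contrapT => /fX[].
  split; first exact: integrable0.
  by rewrite Rintegral_cst // mul0r mulr0.
pose f' x := if abs (x - c) < r then 0 else f x.
have [x y xy|x|S hS] := IH f'.
- rewrite /f' (fc _ _ xy).
  have -> // : (abs (x - c) < r) = (abs (y - c) < r).
  apply/idP/idP => h; last exact: (abs_dist_lt ua xy h).
  by apply: (abs_dist_lt ua (y := x)) => //; rewrite (abs_B ua).
- rewrite /f'; case: ifP => // h /fX[d]; rewrite inE => /orP[/eqP-> hd|dX hd].
    by rewrite hd in h.
  by exists d.
exists (f c + S) => mu hmu; have [If' Ef'] := hS mu hmu.
have mB := measurable_adic_ball c r.
have I1 := integrable_indic_lty mB (haar_ball_lty c r hmu).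
have Ic : mu.-integrable setT (EFin \o (fun x : borel abs => f c * \1_(adic_ball c r) x)).
  rewrite (_ : EFin \o _ = (fun x => (f c)%:E * (EFin \o \1_(adic_ball c r)) x)%E) //.
  exact: integrableZl.
have fE : f = (fun x : borel abs => f c * \1_(adic_ball c r) x + f' x).
  apply/funext => x; rewrite /f' indicE; have [h|h] := pselect (adic_ball c r x).
    by rewrite mem_set // mulr1 (_ : abs _ < r) // addr0; exact: fc.
  by rewrite memNset // mulr0 add0r ifN //; apply/negP.
set k := f c in fE Ic *; rewrite fE; split.
  rewrite (_ : EFin \o _ =
    (EFin \o (fun x : borel abs => k * \1_(adic_ball c r) x)) \+ (EFin \o f')) //.
  exact: integrableD.
rewrite RintegralD // RintegralZl // Ef' mulrDr mulrC; congr (_ * _ + _).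
rewrite /Rintegral integral_indic // setIT; congr fine; exact: haar_ball_translate.
Qed.

(** All smaller radii are allowed, so that two functions can be compared at a common one. *)
Lemma haar_cintegral (G : K -> R[i]) : uniformly_schwartz abs 0 G ->
  exists2 r0, 0 < r0 & forall r, 0 < r <= r0 -> exists S : R[i],
    forall mu : {measure set (borel abs) -> \bar R}, haar mu ->
      cintegral mu setT (G : borel abs -> R[i]) =
      (fine (mu (adic_ball 0 r)))%:C%C * S.
Proof.
move=> [e [M [e0 Gc GM]]]; exists e => // r /andP[r0 re].
have [X hX] := tb M r0.
have [x y xy|x h|S1 h1] := @haar_Rintegral r X (fun x => complex.Re (G x)).
- by rewrite (Gc x y) // (lt_le_trans xy).
- by apply/hX/GM => G0; apply: h; rewrite G0.
have [x y xy|x h|S2 h2] := @haar_Rintegral r X (fun x => complex.Im (G x)).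
- by rewrite (Gc x y) // (lt_le_trans xy).
- by apply/hX/GM => G0; apply: h; rewrite G0.
exists (S1 +i* S2)%C => mu hmu; have [_ E1] := h1 mu hmu; have [_ E2] := h2 mu hmu.
rewrite /cintegral E1 E2; apply/eqP; rewrite eq_complex /=.
by rewrite !mul0r subr0 addr0 !eqxx.
Qed.

(** Uniqueness of Haar integrals up to a factor, cross-multiplied so that no volume is divided
    by. *)
Lemma haar_cintegral_comm (mu mu' : {measure set (borel abs) -> \bar R}) (G G' : K -> R[i]) :
  haar mu -> haar mu' -> uniformly_schwartz abs 0 G -> uniformly_schwartz abs 0 G' ->
  cintegral mu setT (G : borel abs -> R[i]) * cintegral mu' setT (G' : borel abs -> R[i]) =
  cintegral mu' setT (G : borel abs -> R[i]) * cintegral mu setT (G' : borel abs -> R[i]).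
Proof.
move=> hmu hmu' /haar_cintegral[r r0 hr] /haar_cintegral[r' r'0 hr'].
have m0 : 0 < Num.min r r' by rewrite lt_min r0.
have [|S hS] := hr (Num.min r r'); first by rewrite m0 ge_min lexx.
have [|S' hS'] := hr' (Num.min r r'); first by rewrite m0 ge_min lexx orbT.
rewrite !(hS _ hmu) !(hS _ hmu') !(hS' _ hmu) !(hS' _ hmu'); ring.
Qed.

End HaarIntegral.

(** * Generators of [GL2N] and conjugate representations *)

Section Generators.
Variables (F : fieldType) (E : splittingFieldType F) (C : fieldType).
Variables (W : lmodType C) (V : set W) (rho rho' : GL2 F -> W -> W).
Hypotheses (Ng : mult_subgroup (norm_group E)).
Hypothesis Nsq : forall x : F, x != 0 -> norm_group E (x ^+ 2).
Hypotheses (r : is_rep (GL2N E) V rho) (r' : is_rep (GL2N E) V rho').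

Lemma GL2N_sc (x : F) : x != 0 -> GL2N E (sc x).
Proof. by move=> x0; rewrite /GL2N /= sc_mx // det_mx2 mulr0 subr0; exact: Nsq. Qed.

Lemma rep_eq_generators :
  (forall b v, V v -> rho (un b) v = rho' (un b) v) ->
  (forall x v, x != 0 -> V v -> rho (sc x) v = rho' (sc x) v) ->
  (forall x v, norm_group E x -> V v -> rho (dg x) v = rho' (dg x) v) ->
  (forall v, V v -> rho (we F) v = rho' (we F) v) ->
  forall h v, GL2N E h -> V v -> rho h v = rho' h v.
Proof.
move=> hun hsc hdg hwe h v Hh Vv.
have HM := GL2N_mul Ng.
have eqM g k : GL2N E g -> GL2N E k -> (forall u, V u -> rho g u = rho' g u) ->
    (forall u, V u -> rho k u = rho' k u) -> forall u, V u -> rho (g * k)%g u = rho' (g * k)%g u.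
  move=> Hg Hk eg ek u Vu; rewrite (rep_mul r) // (rep_mul r') // ek // eg //.
  exact: (rep_stable r').
have Hu b : GL2N E (un b) by exact: GL2N_un.
have Hw : GL2N E (we F) by exact: GL2N_we.
set a := gl2_mx h 0 0; set b := gl2_mx h 0 1; set c := gl2_mx h 1 0.
set d := gl2_mx h 1 1.
have hE : h = gl a b c d by exact: gl_eq_entries.
have DE : \det (gl2_mx h) = a * d - b * c by rewrite (mx2E (gl2_mx h)) det_mx2.
have D0 : a * d - b * c != 0 by rewrite -DE; exact: det_gl2_neq0.
have ND : norm_group E (a * d - b * c) by rewrite -DE; exact: Hh.
have [N1 NM NV _] := Ng.
have Ndiv x : x != 0 -> norm_group E ((a * d - b * c) / x ^+ 2).
  by move=> x0; apply: NM => //; apply/NV/Nsq.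
move: v Vv; rewrite hE; have [c0|c0] := eqVneq c 0.
  move: D0; rewrite c0 mulr0 subr0 mulf_eq0 negb_or => /andP[a0 d0].
  have Nad : norm_group E (a / d).
    have -> : a / d = (a * d - b * c) / d ^+ 2 by rewrite c0; field.
    exact: Ndiv.
  have Hd : GL2N E (dg (a / d)) by exact: GL2N_dg.
  have Hs := GL2N_sc d0.
  rewrite bruhat_small //; apply: (eqM) => //; first exact: HM.
    by move=> u; exact: hun.
  apply: (eqM) => // u; first exact: hsc.
  exact: hdg.
have Hd : GL2N E (dg ((a * d - b * c) / c ^+ 2)) by apply: GL2N_dg => //; exact: Ndiv.
have cN0 : - c != 0 by rewrite oppr_eq0.
have Hs := GL2N_sc cN0.
have H1 := HM _ _ Hw (Hu (d / c)).
have H2 := HM _ _ Hd H1.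
have H3 := HM _ _ Hs H2.
rewrite bruhat_big //; apply: (eqM) => //; first by move=> u; exact: hun.
apply: (eqM) => //; first by move=> u; exact: hsc.
apply: (eqM) => //; first by move=> u; apply: hdg; exact: Ndiv.
by apply: (eqM) => // u; exact: hun.
Qed.

(** Any g in GL(2,F) is allowed: [GL2N] is normal, being defined by the determinant. *)
Lemma is_rep_conj (g : GL2 F) : is_rep (GL2N E) V (fun h => rho (g * h * g^-1)%g).
Proof.
split.
- exact: rep_subspace r.
- by move=> h v Hh Vv; apply: (rep_stable r) => //; exact: GL2N_conj.
- by move=> h Hh; apply: (rep_linear r); exact: GL2N_conj.
- by move=> v Vv; rewrite mulg1 mulgV (rep_one r).
- move=> h k v Hh Hk Vv; rewrite -(rep_mul r) ?GL2N_conj //; try exact: GL2N_conj.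
  by congr rho; rewrite !mulgA mulgKV.
Qed.

End Generators.

(** * Comparison of the representations for psi and psi' *)

Section Comparison.
Variables (R : realType) (F : fieldType) (abs : F -> R).
Variables (E : splittingFieldType F) (Delta : F) (delta : E) (sigma : gal_of {:E}).
Variables (Theta : E -> R[i]) (psi psi' : F -> R[i]).
Variables (mu mu' : {measure set (borel (@absE F E R abs)) -> \bar R}).
Variable rho rho' : GL2 F -> (E -> R[i]^o) -> (E -> R[i]^o).
Hypotheses (lf : local_field abs) (ch0 : [pchar F] =i pred0).
Hypotheses (sG : sigma \in 'Gal({:E} / 1)%g) (sigma1 : sigma != 1%g).
Hypothesis ap : admissible_pair abs Delta delta Theta.
Hypotheses (nc : nontrivial_add_char abs psi) (nc' : nontrivial_add_char abs psi').
Hypotheses (hmu : haar mu) (hmu' : haar mu').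
Hypotheses (P : is_pi_Theta Delta sigma Theta psi mu rho).
Hypotheses (P' : is_pi_Theta Delta sigma Theta psi' mu' rho').
Variable c : F.
Hypotheses (c0 : c != 0) (psiE : forall x, psi' x = psi (c * x)).

Let qe : quadratic_ext Delta delta. Proof. by case: ap. Qed.
Let ua := local_field_ultrametric lf.
Let uaE := absE_ultrametric qe sG sigma1 lf.
Let ac' : add_char abs psi'. Proof. by case: nc'. Qed.
Let Ng : mult_subgroup (norm_group E) := mult_subgroup_norm sG sigma1 ap.
Let Nsq (x : F) (x0 : x != 0) : norm_group E (x ^+ 2) := norm_group_sqr sG sigma1 ap x0.
Let absE_ge0 (z : E) : 0 <= absE abs z. Proof. by case: uaE. Qed.

Local Notation V := (schwartz_theta abs Theta).
Local Notation H := (GL2N E).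

Let kernel (v : E -> R[i]^o) (z t : E) : R[i] := psi' (trc (t * sigma z)) * v t.

Let kernel_uniform v z : V v -> uniformly_schwartz (absE abs) 0 (kernel v z).
Proof.
move=> Vv; have [e [M [e0 vc vM]]] := schwartz_theta_uniform lf sG sigma1 ap Vv.
have [_ _ [e1 e10 he1]] := ac'.
have z0 : 0 < 1 + absE abs z by rewrite ltr_pwDl.
exists (Num.min e (e1 ^+ 2 / (1 + absE abs z))), M; split.
- by rewrite lt_min e0 divr_gt0 // exprn_gt0.
- move=> x y; rewrite lt_min => /andP[xye xyz]; rewrite /kernel (vc x y xye).
  rewrite -{1}(subrK y x) mulrDl (trcD qe sG sigma1) (add_charD ac').
  rewrite he1 ?mul1r //.
  have lt2 : abs (trc ((x - y) * sigma z)) ^+ 2 < e1 ^+ 2.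
    apply: le_lt_trans (abs_trc qe sG sigma1 lf _) _.
    have -> : absE abs ((x - y) * sigma z) = absE abs (x - y) * absE abs z.
      by rewrite -(absE_sigma qe sG sigma1 abs z); case: uaE => _ _ ->.
    move: xyz; rewrite ltr_pdivlMr //; apply: le_lt_trans.
    by rewrite ler_wpM2l // lerDr.
  by rewrite ltr_pXn2r ?nnegrE ?(lf_abs_ge0 lf) ?ltW // in lt2.
- by move=> x h; apply: vM => vx; apply: h; rewrite /kernel vx mulr0.
Qed.

Let conj (h : GL2 F) : (E -> R[i]^o) -> (E -> R[i]^o) := rho (dg c * h * (dg c)^-1)%g.
Let Pc : is_rep H V conj. Proof. exact: (is_rep_conj (pi_rep P) (dg c)). Qed.
Let P'r := pi_rep P'.

Let Int (m : {measure set (borel (@absE F E R abs)) -> \bar R}) v z : R[i] :=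
  cintegral m setT (kernel v z : borel (@absE F E R abs) -> R[i]).

Let we_int' v z : V v -> rho' (we F) v z =
  weil_index mu' psi' * Int mu' v z.
Proof. by move=> Vv; rewrite (pi_weyl P' z (we_mx F) Vv). Qed.

Let kappa := (hilbert_symbol c Delta)%:~R * (abs c)%:C%C * weil_index mu psi.

(** Conjugating the Weyl element by diag(c,1) multiplies it by diag(c,c^-1), which scales the
    argument by c and turns the Fourier kernel of psi into that of psi'. *)
Let we_int v z : V v -> conj (we F) v z =
  kappa * Int mu v z.
Proof.
move=> Vv; have Hw : H (we F) by exact: GL2N_we.
have cmx : gl2_mx (gl c 0 0 c^-1) = mx2 c 0 0 c^-1.
  by rewrite gl_mx // divff // mul0r subr0 oner_eq0.
have Hc : H (gl c 0 0 c^-1).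
  by rewrite /GL2N /= cmx det_mx2 divff // mul0r subr0; case: Ng.
rewrite /conj dg_conj_we // (rep_mul (pi_rep P)) //.
rewrite (pi_torus P z c0 cmx); last exact: (rep_stable (pi_rep P)).
rewrite (pi_weyl P _ (we_mx F) Vv) mulrA; congr (_ * _).
rewrite /fourier; congr (cintegral mu setT _); apply/funext => t.
by rewrite /kernel psiE gal_scale -scalerAr (trcZ qe sG sigma1).
Qed.

(** Both operators integrate the same kernel against Haar measures, up to constants. The ratio is
    read off at one v0 and z0 where the value is nonzero, which exist as [conj (we F)] is
    invertible. *)
Let we_scalar : exists t : R[i], forall v, V v -> rho' (we F) v = t *: conj (we F) v.
Proof.
have [v0 Vv0 v00] := schwartz_theta_neq0 lf ch0 sG sigma1 ap.
have Hw : H (we F) by exact: GL2N_we.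
have : conj (we F) v0 <> 0.
  by apply: (rep_neq0 Pc) => //; exact: GL2N_inv.
move=> nz; have [z0 hz0] : exists z, conj (we F) v0 z <> 0.
  apply: contrapT => h; apply: nz; apply/funext => z.
  by apply: contrapT => h'; apply: h; exists z.
move: hz0; rewrite we_int // => /eqP; rewrite mulf_eq0 negb_or => /andP[k0 I0].
exists (weil_index mu' psi' * Int mu' v0 z0 / (kappa * Int mu v0 z0)) => v Vv.
apply/funext => z; rewrite we_int' //.
rewrite -[RHS]/(_ * conj (we F) v z) we_int //.
have e : Int mu v0 z0 * Int mu' v z = Int mu' v0 z0 * Int mu v z.
  apply: (haar_cintegral_comm uaE) => //; try exact: kernel_uniform.
  - exact: absE_totally_bounded ch0 sG sigma1 qe.
  - exact: absE_complete ch0 sG sigma1 qe.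
have -> : weil_index mu' psi' * Int mu' v0 z0 / (kappa * Int mu v0 z0) * (kappa * Int mu v z) =
  weil_index mu' psi' * (Int mu' v0 z0 * Int mu v z) / Int mu v0 z0.
  by field; rewrite I0 k0.
by rewrite -e; field.
Qed.

Let we_eq v : V v -> conj (we F) v = rho' (we F) v.
Proof.
have [t ht] := we_scalar.
have [v0 Vv0 v00] := schwartz_theta_neq0 lf ch0 sG sigma1 ap.
have Hw : H (we F) by exact: GL2N_we.
have Hu b : H (un b) by exact: GL2N_un.
have Hs : H (sc (-1)) by apply: (GL2N_sc Nsq); rewrite oppr_eq0 oner_eq0.
have HM := GL2N_mul Ng.
have unE b u : V u -> rho' (un b) u = conj (un b) u.
  move=> Vu; apply/funext => z; rewrite (pi_unipotent P' z (un_mx b) Vu).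
  by rewrite /conj dg_conj_un // (pi_unipotent P z (un_mx _) Vu) psiE mulrA.
have m1 : (-1 : F) != 0 by rewrite oppr_eq0 oner_eq0.
have scE u : V u -> rho' (sc (-1)) u = conj (sc (-1)) u.
  move=> Vu; apply/funext => z; rewrite (pi_central P' z m1 (sc_mx m1) Vu).
  by rewrite /conj dg_conj_sc // (pi_central P z m1 (sc_mx m1) Vu).
have S h u : H h -> V u -> V (conj h u) by move=> Hh Vu; exact: (rep_stable Pc).
have H1 := HM _ _ (Hu 1) Hw; have H2 := HM _ _ Hw H1.
pose x := conj (we F * (un 1 * we F))%g v0.
have x0 : x <> 0 by apply: (rep_neq0 Pc) => //; exact: GL2N_inv.
(* The same vector is computed from both sides of [weyl_relation]: two Weyl factors give t^2 here,
   one gives t in [Rt]. *)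
have L : rho' (we F * (un 1 * we F))%g v0 = (t * t) *: x.
  have Va := S _ _ Hw Vv0; have Vb := S _ _ (Hu 1) Va.
  rewrite (rep_mul P'r Hw H1 Vv0) (rep_mul P'r (Hu 1) Hw Vv0) (ht _ Vv0).
  rewrite (rep_scale P'r _ (Hu 1) Va) (unE _ _ Va) (rep_scale P'r _ Hw Vb) (ht _ Vb).
  by rewrite scalerA /x (rep_mul Pc Hw H1 Vv0) (rep_mul Pc (Hu 1) Hw Vv0).
have Rt : rho' (we F * (un 1 * we F))%g v0 = t *: x.
  have H3 := HM _ _ Hw (Hu (-1)); have H4 := HM _ _ (Hu (-1)) H3.
  have Va := S _ _ (Hu (-1)) Vv0; have Vb := S _ _ Hw Va; have Vd := S _ _ (Hu (-1)) Vb.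
  rewrite /x weyl_relation (rep_mul P'r Hs H4 Vv0) (rep_mul P'r (Hu (-1)) H3 Vv0).
  rewrite (rep_mul P'r Hw (Hu (-1)) Vv0) (unE _ _ Vv0) (ht _ Va).
  rewrite (rep_scale P'r _ (Hu (-1)) Vb) (unE _ _ Vb) (rep_scale P'r _ Hs Vd) (scE _ Vd).
  rewrite (rep_mul Pc Hs H4 Vv0) (rep_mul Pc (Hu (-1)) H3 Vv0).
  by rewrite (rep_mul Pc Hw (Hu (-1)) Vv0).
have t0 : t != 0.
  apply/eqP => t0; have : rho' (we F) v0 <> 0.
    by apply: (rep_neq0 P'r) => //; exact: GL2N_inv.
  by rewrite (ht _ Vv0) t0 scale0r.
have t1 : t = 1.
  have : (t * (t - 1)) *: x = 0 by rewrite mulrBr mulr1 scalerBl -L -Rt subrr.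
  move/eqP; rewrite scaler_eq0 mulf_eq0 (negbTE t0) subr_eq0 => /orP[/eqP//|/eqP xx].
  by case: x0.
by move=> Vv; rewrite (ht _ Vv) t1 scale1r.
Qed.

Lemma pi_Theta_conj h v : H h -> V v -> rho (dg c * h * (dg c)^-1)%g v = rho' h v.
Proof.
move=> Hh Vv; apply: (rep_eq_generators Ng Nsq Pc P'r) => // {h v Hh Vv}.
- move=> b v Vv; apply/funext => z; rewrite (pi_unipotent P' z (un_mx b) Vv).
  by rewrite /conj dg_conj_un // (pi_unipotent P z (un_mx _) Vv) psiE mulrA.
- move=> x v x0 Vv; apply/funext => z; rewrite (pi_central P' z x0 (sc_mx x0) Vv).
  by rewrite /conj dg_conj_sc // (pi_central P z x0 (sc_mx x0) Vv).
- move=> _ v [zeta /= z0 <-] Vv; apply/funext => z.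
  have n0 : nrm zeta != 0 by rewrite (nrm_eq0 qe sG sigma1).
  rewrite (pi_norm P' z z0 (dg_mx n0) Vv).
  by rewrite /conj dg_conj_dg // (pi_norm P z z0 (dg_mx n0) Vv).
Qed.

(** The intertwiner is left translation by diag(c,1). It commutes with right translations, and by
    [pi_Theta_conj] it turns equivariance under [rho] into equivariance under [rho']. *)
Theorem Ind_equivalent : equivalent_rep [set: GL2 F]
  (Ind abs H V rho) (@right_translation F (E -> R[i]^o))
  (Ind abs H V rho') (@right_translation F (E -> R[i]^o)).
Proof.
exists (fun f x => f (dg c * x)%g); split; last first.
- by move=> h f _ _; apply/funext => x; rewrite /right_translation mulgA.
- by [].
split.
- move=> f [Vf Hf [e e0 he]]; split=> [x|h x Hh|]; first exact: Vf.
    rewrite -pi_Theta_conj // -Hf; last exact: GL2N_conj.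
    by rewrite !mulgA mulgKV.
  by exists e => // k hk x; rewrite mulgA; exact: he.
- move=> f g _ _ /(congr1 (fun u x => u ((dg c)^-1 * x)%g)) fg.
  by apply/funext => x; have := congr1 (fun u => u x) fg; rewrite /= mulKVg.
- move=> f [Vf Hf [e e0 he]]; exists (fun x => f ((dg c)^-1 * x)%g); last first.
    by apply/funext => x; rewrite mulKg.
  split=> [x|h x Hh|]; first exact: Vf.
    have Hc : H ((dg c)^-1 * h * (dg c)^-1^-1)%g by exact: GL2N_conj.
    have -> : ((dg c)^-1 * (h * x))%g =
        (((dg c)^-1 * h * (dg c)^-1^-1) * ((dg c)^-1 * x))%g.
      by rewrite !mulgA mulgKV.
    rewrite (Hf _ _ Hc) -pi_Theta_conj //; congr rho.
    by rewrite invgK !mulgA mulgV mul1g mulgK.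
  by exists e => // k hk x; rewrite mulgA; exact: he.
Qed.

End Comparison.

Theorem theorem6 (R : realType) (F : fieldType) (abs : F -> R)
    (E : splittingFieldType F) (Delta : F) (delta : E) (sigma : gal_of {:E})
    (Theta : E -> R[i]) :
  local_field abs ->
  [pchar F] =i pred0 ->
  sigma \in 'Gal({:E} / 1)%g -> sigma != 1%g ->
  admissible_pair abs Delta delta Theta ->
  (forall (psi : F -> R[i])
      (rho : GL2 F -> (E -> R[i]^o) -> (E -> R[i]^o)),
    nontrivial_add_char abs psi ->
    pi_Theta_psi abs Delta sigma Theta psi rho ->
    irreducible_rep [set: GL2 F]
      (Ind abs (GL2N E) (schwartz_theta abs Theta) rho)
      (@right_translation F (E -> R[i]^o))) /\
  (forall (psi psi' : F -> R[i])
      (rho rho' : GL2 F -> (E -> R[i]^o) -> (E -> R[i]^o)),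
    nontrivial_add_char abs psi -> nontrivial_add_char abs psi' ->
    pi_Theta_psi abs Delta sigma Theta psi rho ->
    pi_Theta_psi abs Delta sigma Theta psi' rho' ->
    equivalent_rep [set: GL2 F]
      (Ind abs (GL2N E) (schwartz_theta abs Theta) rho)
      (@right_translation F (E -> R[i]^o))
      (Ind abs (GL2N E) (schwartz_theta abs Theta) rho')
      (@right_translation F (E -> R[i]^o))).
Proof.
move=> lf ch0 sG sigma1 ap; split.
  move=> psi rho nc [mu [_ _ P]].
  exact: Ind_irreducible lf ch0 sG sigma1 ap nc P.
move=> psi psi' rho rho' nc nc' [mu [hmu _ P]] [mu' [hmu' _ P']].
have [c c0 psiE] := add_char_scale lf nc nc'.
exact (Ind_equivalent lf ch0 sG sigma1 ap nc' hmu hmu' P P' c0 psiE).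
Qed.
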